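(* There exist an algorithm and an absolute constant $C>0$ with the following property. For all integers $n\ge 2$, $q\ge 2$ and every probability distribution $\mu$ on $[q]^n$, the algorithm, interacting in rounds with a conditional-marginal oracle for $\mu$, outputs a random vector whose law is exactly $\mu$; the expected total number of oracle queries it makes is at most $Cn$; and the expected number of rounds is at most $$C\, n^{2/3}\cdot \min\{\log^{2/3} n\cdot \log q,\; q^{1/3}\log^{1/3} q\}.$$
   Context: $[n]=\{1,\dots,n\}$. Let $X=(X_1,\dots,X_n)\sim\mu$. A conditional-marginal oracle for $\mu$ answers a query $(i,S,\sigma_S)$, with $i\in[n]$, $S\subseteq[n]$, $\sigma_S\in[q]^S$, by returning the whole vector $\big(\mathbb P_{X\sim\mu}[X_i=x\mid X_S=\sigma_S]\big)_{x\in[q]}$. The algorithm interacts with the oracle in rounds: in each round it submits a finite set of queries, chosen as a function of its internal randomness and of all answers received in previous rounds, and receives all of their answers simultaneously. The number of rounds is the number of such interactions before the algorithm produces its output. *)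

(* Defs.v *)
From HB Require Import structures.
From mathcomp Require Import all_boot all_order all_algebra.
From mathcomp Require Import classical_sets reals ereal sequences exp.
Set Implicit Arguments. Unset Strict Implicit. Unset Printing Implicit Defensive.
Import Order.TTheory GRing.Theory Num.Theory.
Local Open Scope ring_scope.

Section Model.
Variable R : realType.

Definition config (n q : nat) := {ffun 'I_n -> 'I_q}.

Definition is_distribution n q (mu : {ffun config n q -> R}) :=
  (forall x, 0 <= mu x) /\ \sum_(x : config n q) mu x = 1.

(* a query (i, S, sigma_S): sigma : 'I_n -> option 'I_q, with
   S = [set j | sigma j != None] and sigma_S given by the Some-values *)
Definition query (n q : nat) := ('I_n * {ffun 'I_n -> option 'I_q})%type.

Definition agrees n q (sigma : {ffun 'I_n -> option 'I_q}) (x : config n q) : bool :=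
  [forall j, if sigma j is Some a then x j == a else true].

Definition cond_prob n q (mu : {ffun config n q -> R}) sigma :=
  \sum_(x : config n q | agrees sigma x) mu x.

Definition joint_prob n q (mu : {ffun config n q -> R}) (i : 'I_n) sigma (a : 'I_q) :=
  \sum_(x : config n q | agrees sigma x && (x i == a)) mu x.

(* oracle: answers every query by a vector indexed by [q].  It is a
   conditional-marginal oracle for mu if it answers correctly every query
   whose conditioning event has positive probability (queries conditioned
   on null events may be answered arbitrarily). *)
Definition oracle n q := query n q -> {ffun 'I_q -> R}.

Definition is_cm_oracle n q (mu : {ffun config n q -> R}) (O : oracle n q) :=
  forall (qu : query n q), 0 < cond_prob mu qu.2 ->
    forall a, O qu a = joint_prob mu qu.1 qu.2 a / cond_prob mu qu.2.

(* transcript of one round: for every query, Some answer if it was submitted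
   in that round, None otherwise *)
Definition round_record n q := {ffun query n q -> option {ffun 'I_q -> R}}.
Definition history n q := seq (round_record n q).

(* an action: either output a vector of [q]^n, or submit a (finite) set of
   queries for the next round *)
Definition action n q := (config n q + {set query n q})%type.

(* randomized algorithm in behavioural form: given the history of all
   previous rounds (queries and answers), a probability distribution over
   the next action *)
Definition strategy n q := history n q -> {ffun action n q -> R}.

Definition valid_strategy n q (A : strategy n q) :=
  forall h, (forall a, 0 <= A h a) /\ \sum_(a : action n q) A h a = 1.

Definition record_of n q (O : oracle n q) (s : {set query n q}) : round_record n q :=
  [ffun qu => if qu \in s then Some (O qu) else None].

Definition hist_of n q (O : oracle n q) (ss : seq {set query n q}) : history n q :=
  map (record_of O) ss.

Definition reach n q (A : strategy n q) (O : oracle n q) (ss : seq {set query n q}) :=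
  \prod_(j < size ss) A (hist_of O (take j ss)) (inr (nth (@finset.set0 _) ss j)).

Definition out_prob n q (A : strategy n q) (O : oracle n q) (k : nat) (x : config n q) :=
  \sum_(ss : k.-tuple {set query n q})
     reach A O ss * A (hist_of O ss) (inl x).

Definition stop_prob n q (A : strategy n q) (O : oracle n q) (k : nat) :=
  \sum_(x : config n q) out_prob A O k x.

Definition query_mass n q (A : strategy n q) (O : oracle n q) (k : nat) :=
  \sum_(ss : k.-tuple {set query n q})
     reach A O ss * (\sum_(x : config n q) A (hist_of O ss) (inl x))
       * (\sum_(s <- ss) #|s|)%:R.

End Model.

(* Main.v *)
Require Import Defs.
From HB Require Import structures.
From mathcomp Require Import all_boot all_order all_algebra.
From mathcomp Require Import classical_sets reals ereal sequences exp.
From mathcomp Require Import perm topology normedtype.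
From mathcomp Require Import finset ring lra.
Import Order.TTheory GRing.Theory Num.Theory.
Local Open Scope ring_scope.
Set Implicit Arguments. Unset Strict Implicit. Unset Printing Implicit Defensive.

(* Process the coordinates in a uniformly random order, cut into blocks of
   length th ~ (n / ln q)^(1/3).  When a block is opened at a partial assignment
   x0, query all its marginals p_j given x0 and guess Y_j ~ p_j independently.
   Then query the true marginals r_j given the assignment so far completed by the
   guesses before j, and couple (p_j, r_j) maximally: everything up to the first
   wrong guess is settled (and that guess corrected) in one round.  After a
   correction, fresh guesses are drawn from the same p_j.  Since the
   reference x0 does not depend on where the corrections fall, j is corrected with
   probability exactly E TV(p_j, r_j).  A pointwise inequality
   TV <= t + KL(r_j | p_j) / t with t = 1 / th reduces the number of corrections to
   entropy increments; averaged over the order these increments are decreasing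
   (submodularity and exchangeability), so the KL terms telescope to at most
   (th - 1) ln q.  Hence O(n / th + th^2 ln q) = O(n^(2/3) (ln q)^(1/3)) rounds of at
   most 2 th queries each, which is stronger than the stated bound. *)

(** * Finitely supported weighted laws *)

Section Dist.
Variable R : realType.

(** Lists of weighted values, since hidden states range over an infinite type. Weights need not add
    up to one, so discarding outcomes gives unnormalised conditional laws. Laws are compared only
    through [expect]. *)
Definition dist (T : Type) := seq (R * T).

Definition expect T (d : dist T) (f : T -> R) : R := \sum_(w <- d) w.1 * f w.2.

Definition ret T (t : T) : dist T := [:: (1, t)].

Definition bind T U (d : dist T) (k : T -> dist U) : dist U :=
  [seq (w.1 * v.1, v.2) | w <- d, v <- k w.2].

Definition dnonneg T (d : dist T) := all (fun w => 0 <= w.1) d.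

Definition draw (I : finType) (v : I -> R) : dist I :=
  [seq (v a, a) | a <- enum I].

Lemma expect_ret T (t : T) f : expect (ret t) f = f t.
Proof. by rewrite /expect big_seq1 mul1r. Qed.

Lemma expect_nil T (f : T -> R) : expect [::] f = 0.
Proof. by rewrite /expect big_nil. Qed.

Lemma expect_bind T U (d : dist T) (k : T -> dist U) f :
  expect (bind d k) f = expect d (fun t => expect (k t) f).
Proof.
rewrite /expect big_allpairs_dep; apply: eq_bigr => w _.
by rewrite mulr_sumr; apply: eq_bigr => v _; rewrite mulrA.
Qed.

Lemma expect_draw (I : finType) (v : I -> R) f :
  expect (draw v) f = \sum_a v a * f a.
Proof. by rewrite /expect big_map big_enum. Qed.

Lemma eq_expect T (d : dist T) f g : f =1 g -> expect d f = expect d g.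
Proof. by move=> fg; apply: eq_bigr => w _; rewrite fg. Qed.

Lemma expectD T (d : dist T) f g :
  expect d (fun t => f t + g t) = expect d f + expect d g.
Proof. by rewrite /expect -big_split; apply: eq_bigr => w _; rewrite mulrDr. Qed.

Lemma expectZ T (d : dist T) c f :
  expect d (fun t => c * f t) = c * expect d f.
Proof. by rewrite /expect mulr_sumr; apply: eq_bigr => w _; rewrite mulrCA. Qed.

Lemma expect_cst T (d : dist T) c :
  expect d (fun=> c) = c * expect d (fun=> 1).
Proof. by rewrite -expectZ; apply: eq_expect => t; rewrite mulr1. Qed.

Lemma expect_sum (I : Type) (r : seq I) T (d : dist T) (f : I -> T -> R) :
  expect d (fun t => \sum_(i <- r) f i t) = \sum_(i <- r) expect d (f i).
Proof.
rewrite /expect exchange_big; apply: eq_bigr => w _.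
by rewrite mulr_sumr.
Qed.

Lemma le_expect T (d : dist T) f g : dnonneg d -> (forall t, f t <= g t) ->
  expect d f <= expect d g.
Proof.
move=> d0 fg; elim: d d0 => [|w d IH] /=; first by rewrite !expect_nil.
case/andP=> w0 d0; rewrite /expect !big_cons lerD ?ler_wpM2l //.
exact: IH.
Qed.

Lemma expect_ge0 T (d : dist T) f : dnonneg d -> (forall t, 0 <= f t) ->
  0 <= expect d f.
Proof.
by move=> d0 f0; have := le_expect d0 f0; rewrite expect_cst mul0r.
Qed.

Lemma dnonneg_ret T (t : T) : dnonneg (ret t).
Proof. by rewrite /dnonneg /= ler01. Qed.

Lemma dnonneg_draw (I : finType) (v : I -> R) :
  (forall a, 0 <= v a) -> dnonneg (draw v).
Proof. by move=> v0; rewrite /dnonneg all_map; apply/allP => a _ /=. Qed.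

Lemma dnonneg_bind T U (d : dist T) (k : T -> dist U) :
  dnonneg d -> (forall t, dnonneg (k t)) -> dnonneg (bind d k).
Proof.
move=> d0 k0; elim: d d0 => [//|w d IH] /= /andP[w0 d0].
rewrite /dnonneg /bind /= all_cat all_map; apply/andP; split; last exact: IH.
by apply: sub_all (k0 w.2) => v v0 /=; apply: mulr_ge0.
Qed.

Lemma expect1_bind T U (d : dist T) (k : T -> dist U) :
  (forall t, expect (k t) (fun=> 1) = 1) ->
  expect (bind d k) (fun=> 1) = expect d (fun=> 1).
Proof. by move=> k1; rewrite expect_bind; apply: eq_expect. Qed.

End Dist.

Arguments ret : simpl never.
Arguments bind : simpl never.
Arguments draw : simpl never.
Arguments dnonneg : simpl never.

(** * From hidden states to behavioural strategies *)

Section Behavioural.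
Variables (R : realType) (n q : nat) (S : Type).
Variable Q : S -> {set query n q}.
Variable K : oracle R n q -> S -> dist R (S + config n q).
Variable init : dist R (S + config n q).

Hypothesis init0 : dnonneg init.
Hypothesis init1 : expect init (fun=> 1) = 1.
Hypothesis K0 : forall O s, dnonneg (K O s).
Hypothesis K1 : forall O s, expect (K O s) (fun=> 1) = 1.
Hypothesis K_local : forall (O O' : oracle R n q) s,
  {in Q s, O =1 O'} -> forall f, expect (K O s) f = expect (K O' s) f.

Definition queried (r : round_record R n q) : {set query n q} :=
  [set qu | isSome (r qu)].

Definition replay (r : round_record R n q) : oracle R n q :=
  fun qu => odflt [ffun=> 0] (r qu).

(** An unnormalised Bayes update: hidden states whose query set differs from the recorded one are
    discarded, so the remaining mass is the likelihood of the record. *)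
Definition observe (d : dist R (S + config n q)) (r : round_record R n q) :=
  bind d (fun z => if z is inl s then
                     if Q s == queried r then K (replay r) s else [::]
                   else [::]).

Definition posterior (h : history R n q) := foldl observe init h.

Definition act (z : S + config n q) : action n q :=
  match z with inl s => inr (Q s) | inr x => inl x end.

(* A strategy has no memory besides the history, so the next action is drawn from
   the conditional law of the hidden state given the history; by [K_local] the
   recorded answers suffice to compute it. *)
Definition filtering : strategy R n q := fun h =>
  [ffun a => if expect (posterior h) (fun=> 1) == 0 then (a == inr finset.set0)%:R
             else expect (posterior h) (fun z => (act z == a)%:R)
                    / expect (posterior h) (fun=> 1)].

(** Stopped runs are dropped, so the outputs in [chain O k] come from the runs that stop after
    exactly [k] rounds. *)
Definition advance O (d : dist R (S + config n q)) :=
  bind d (fun z => if z is inl s then K O s else [::]).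

Definition chain O k := iter k (advance O) init.

Lemma dnonneg_observe d r : dnonneg d -> dnonneg (observe d r).
Proof.
by move=> d0; apply: dnonneg_bind => // -[s|x] //; case: ifP.
Qed.

Lemma dnonneg_posterior h : dnonneg (posterior h).
Proof.
rewrite /posterior; elim: h init init0 => [//|r h IH] d d0 /=.
exact/IH/dnonneg_observe.
Qed.

Lemma sum_act d : \sum_(a : action n q) expect d (fun z => (act z == a)%:R) =
  expect d (fun=> 1) :> R.
Proof.
rewrite -expect_sum; apply: eq_expect => z.
by rewrite (bigD1 (act z)) //= eqxx big1 ?addr0 // => a /negbTE; rewrite eq_sym => ->.
Qed.

Lemma filtering_valid : valid_strategy filtering.
Proof.
move=> h; have p0 := dnonneg_posterior h; split=> [a|].
  rewrite ffunE; case: ifP => _; first exact: ler0n.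
  by rewrite divr_ge0 ?expect_ge0 // => z; apply: ler0n.
under eq_bigr do rewrite ffunE.
case: eqVneq => [_|m0]; last by rewrite -mulr_suml sum_act divff.
by rewrite (bigD1 (inr finset.set0)) //= eqxx big1 ?addr0 // => a /negbTE ->.
Qed.

(** Multiplying by the mass absorbs the default of [filtering]: at zero mass the right side lies
    between zero and the mass. *)
Lemma filteringE h a :
  expect (posterior h) (fun=> 1) * filtering h a =
  expect (posterior h) (fun z => (act z == a)%:R).
Proof.
rewrite ffunE; case: eqVneq => [m0|m0]; last by rewrite mulrC divfK.
rewrite m0 mul0r; apply/eqP; rewrite eq_sym eq_le expect_ge0 ?andbT //;
  try by [apply: dnonneg_posterior | move=> z; apply: ler0n].
rewrite -m0; apply: le_expect; first exact: dnonneg_posterior.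
by move=> z; rewrite lern1 leq_b1.
Qed.

Lemma queried_record O s : queried (record_of (R := R) O s) = s.
Proof. by apply/setP => qu; rewrite inE ffunE; case: ifP. Qed.

(** On a genuine record the replayed oracle agrees with [O] on the queries of the surviving states,
    so locality puts [O] back. *)
Lemma expect_observe O d s f : expect (observe d (record_of O s)) f =
  expect d (fun z => (act z == inr s)%:R *
                     expect (if z is inl t then K O t else [::]) f).
Proof.
rewrite expect_bind; apply: eq_expect => -[t|x] /=; last by rewrite expect_nil mulr0.
rewrite queried_record; have -> : (inr (Q t) == inr s :> action n q) = (Q t == s) by [].
case: eqP => [<-|_]; last by rewrite expect_nil mul0r.
by rewrite mul1r; apply: K_local => qu quQ; rewrite /replay ffunE quQ.
Qed.

Lemma reach_rcons (A : strategy R n q) O ss s :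
  reach A O (rcons ss s) = reach A O ss * A (hist_of O ss) (inr s).
Proof.
rewrite /reach size_rcons big_ord_recr /=; congr (_ * _).
  apply: eq_bigr => j _; rewrite nth_rcons ltn_ord.
  by rewrite -cats1 takel_cat // ltnW.
by rewrite nth_rcons ltnn eqxx -cats1 take_size_cat.
Qed.

Lemma posterior_rcons h r : posterior (rcons h r) = observe (posterior h) r.
Proof. by rewrite /posterior -cats1 foldl_cat. Qed.

(** Each factor of [reach] is the ratio of two successive posterior masses, so the product
    telescopes. *)
Lemma reachE O ss :
  reach filtering O ss = expect (posterior (hist_of O ss)) (fun=> 1).
Proof.
elim/last_ind: ss => [|ss s IH].
  by rewrite /reach big_ord0 /posterior /= init1.
rewrite reach_rcons IH filteringE /hist_of map_rcons posterior_rcons expect_observe.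
apply: eq_expect => -[t|x] /=; first by rewrite K1 mulr1.
by rewrite expect_nil mulr0.
Qed.

(** The bridge from strategy to hidden chain: among all possible records of a round, a hidden state
    survives exactly the one for its own query set. *)
Lemma sum_posterior O k f :
  \sum_(ss : k.-tuple {set query n q}) expect (posterior (hist_of O ss)) f =
  expect (chain O k) f.
Proof.
rewrite /posterior /chain; elim: k init => [|k IH] d.
  by rewrite (bigD1 [tuple]) //= big1 ?addr0 // => t /eqP[]; rewrite [LHS]tuple0.
rewrite iterSr -IH.
have cons_bij : bijective (fun p : {set query n q} * k.-tuple {set query n q} =>
                              [tuple of p.1 :: p.2]).
  exists (fun t : k.+1.-tuple _ => (thead t, [tuple of behead t])) => [[x t]|t].
    by rewrite theadE; congr (_, _); apply: val_inj.
  by rewrite -tuple_eta.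
rewrite (reindex _ (onW_bij _ cons_bij)) /=.
rewrite -(pair_bigA _ (fun s (t : k.-tuple _) =>
   expect (foldl observe (observe d (record_of O s)) (hist_of O t)) f)) /=.
rewrite exchange_big; apply: eq_bigr => t _ /=.
(* Observation is linear in the starting law, which may therefore be decomposed into point
   masses. *)
have foldlE h d' : expect (foldl observe d' h) f =
    expect d' (fun z => expect (foldl observe (ret R z) h) f).
  elim: h d' => [|r h IHh] d' /=; first by apply: eq_expect => z; rewrite expect_ret.
  rewrite IHh expect_bind; apply: eq_expect => z.
  by rewrite IHh /observe expect_bind expect_ret.
rewrite foldlE /advance expect_bind.
under eq_bigr do rewrite foldlE expect_observe.
rewrite -expect_sum; apply: eq_expect => z.
rewrite -mulr_suml; case: z => [u|x] /=; last by rewrite expect_nil mulr0.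
rewrite (bigD1 (Q u)) //= eqxx big1 ?addr0 ?mul1r // => s.
by rewrite eq_sym => /negbTE su; rewrite [_ == _]su.
Qed.

Lemma out_probE O k x :
  out_prob filtering O k x = expect (chain O k) (fun z => (act z == inl x)%:R).
Proof.
rewrite -sum_posterior; apply: eq_bigr => ss _.
by rewrite reachE filteringE.
Qed.

(** * Stopping time and query count of the strategy *)

Definition terminal (z : S + config n q) := if z is inr _ then true else false.

Lemma stop_probE O k :
  stop_prob filtering O k = expect (chain O k) (fun z => (terminal z)%:R).
Proof.
rewrite /stop_prob; under eq_bigr do rewrite out_probE.
rewrite -expect_sum; apply: eq_expect => -[s|x] /=; first by rewrite big1.
rewrite (bigD1 x) //= eqxx big1 ?addr0 // => y yx.
by rewrite [_ == _](_ : _ = (x == y)) // eq_sym (negbTE yx).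
Qed.

Lemma dnonneg_chain O k : dnonneg (chain O k).
Proof. by elim: k => [//|k IH] /=; apply: dnonneg_bind => // -[]. Qed.

Definition alive O k := expect (chain O k) (fun z => (~~ terminal z)%:R).

Lemma alive_ge0 O k : 0 <= alive O k.
Proof. by apply: expect_ge0 => [|z]; [apply: dnonneg_chain | apply: ler0n]. Qed.

Lemma stop_prob_ge0 O k : 0 <= stop_prob filtering O k.
Proof.
by rewrite stop_probE; apply: expect_ge0 => [|z]; [apply: dnonneg_chain | apply: ler0n].
Qed.

Lemma alive0 O : stop_prob filtering O 0 + alive O 0 = 1.
Proof.
rewrite stop_probE -expectD /= -[RHS]init1; apply: eq_expect => -[s|x] /=; rewrite ?addr0 ?add0r //.
Qed.

Lemma aliveS O k : alive O k = stop_prob filtering O k.+1 + alive O k.+1.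
Proof.
rewrite stop_probE -expectD expect_bind; apply: eq_expect => -[s|x] /=.
  by rewrite -[LHS](K1 O s); apply: eq_expect => -[t|y] /=; rewrite ?addr0 ?add0r.
by rewrite expect_nil.
Qed.

Lemma sum_stop_prob O N :
  \sum_(0 <= k < N.+1) stop_prob filtering O k = 1 - alive O N.
Proof.
elim: N => [|N IH]; first by rewrite big_nat1; have := alive0 O; lra.
by rewrite big_nat_recr //= IH aliveS; lra.
Qed.

(** Tail-sum formula for the mean of the number of rounds truncated at [N], by summation by
    parts. *)
Lemma sum_rounds O N :
  \sum_(0 <= k < N.+1) k%:R * stop_prob filtering O k + N%:R * alive O N =
  \sum_(0 <= k < N) alive O k.
Proof.
elim: N => [|N IH]; first by rewrite big_nat1 big_geq // !mul0r addr0.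
rewrite big_nat_recr //= [RHS]big_nat_recr //= -IH (aliveS O N).
rewrite -natr1; ring.
Qed.

Variable B : nat.
Hypothesis Q_bound : forall s, (#|Q s| <= B)%N.

Lemma query_mass_le O k :
  query_mass filtering O k <= B%:R * (k%:R * stop_prob filtering O k).
Proof.
(* A sequence containing a set of more than [B] queries has reach zero, as no hidden state submits
   such a set. *)
have cost ss : reach filtering O ss != 0 -> (\sum_(s <- ss) #|s| <= B * size ss)%N.
  elim/last_ind: ss => [|ss s IH]; first by rewrite big_nil.
  rewrite reach_rcons mulf_eq0 negb_or => /andP[r0 As].
  rewrite -cats1 big_cat big_seq1 size_cat addn1 mulnS addnC leq_add ?IH //.
  rewrite leqNgt; apply: contra r0 => Bs.
  rewrite -(mulIr_eq0 _ (mulIf As)) reachE filteringE.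
  rewrite -[X in _ == X](mul0r (expect (posterior (hist_of O ss)) (fun=> 1))).
  rewrite -expect_cst; apply/eqP/eq_expect => -[t|x]; last by [].
  have -> : (act (inl t) == inr s) = (Q t == s) by [].
  by case: eqP => [Qs|_]; [move: (Q_bound t); rewrite Qs leqNgt Bs | rewrite mulr0n].
rewrite /query_mass /stop_prob /out_prob exchange_big /= mulrA big_distrr /=.
apply: ler_sum => ss _; rewrite -big_distrr /= mulrC.
case: (eqVneq (reach filtering O ss) 0) => [->|r0]; first by rewrite !mul0r !mulr0.
apply: ler_wpM2r.
  rewrite mulr_ge0 ?sumr_ge0 // => [|x _]; last by have [] := filtering_valid (hist_of O ss).
  by rewrite reachE expect_ge0 // dnonneg_posterior.
by rewrite -natrM ler_nat -{2}(size_tuple ss) cost.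
Qed.

Lemma query_mass_ge0 O k : 0 <= query_mass filtering O k.
Proof.
apply: sumr_ge0 => ss _; rewrite !mulr_ge0 ?ler0n ?sumr_ge0 // => [|x _].
  by rewrite reachE expect_ge0 // dnonneg_posterior.
by have [] := filtering_valid (hist_of O ss).
Qed.

(* An exact solution [V] of the one-step equation, with cost [c] per round and
   reward [g] on the output, accounts for everything the run collects. *)
Variables (c : R) (g : config n q -> R) (V : S -> R).

Definition value (z : S + config n q) := match z with inl s => V s | inr x => g x end.

Lemma potential_chain O N :
  (forall s, V s = c + expect (K O s) value) ->
  expect init value =
    c * \sum_(0 <= k < N) alive O k
    + \sum_(0 <= k < N) expect (chain O k) (fun z => if z is inr x then g x else 0)
    + expect (chain O N) value.
Proof.
move=> VE; elim: N => [|N ->]; first by rewrite !big_geq // mulr0 !add0r.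
rewrite !big_nat_recr //= mulrDr.
have -> : expect (chain O N) value = c * alive O N
   + expect (chain O N) (fun z => if z is inr x then g x else 0)
   + expect (advance O (chain O N)) value.
  rewrite expect_bind -expectZ -!expectD; apply: eq_expect => -[s|x] /=.
    by rewrite VE; lra.
  by rewrite expect_nil; lra.
by lra.
Qed.

End Behavioural.

(** * Maximal coupling *)

Lemma minD_max0 (R : realDomainType) (x y : R) :
  Num.min x y + Num.max 0 (y - x) = y.
Proof. by rewrite /Num.min /Num.max subr_gt0; case: (ltP x y) => _; lra. Qed.

Section Coupling.
Variables (R : realType) (I : finType).
Implicit Types p r : I -> R.

Definition pmf p := (forall a, 0 <= p a) /\ \sum_a p a = 1.

Definition accept p r b := Num.min 1 (r b / p b).

(** The total variation distance when both masses are one. *)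
Definition excess p r := \sum_a Num.max 0 (r a - p a).

(** The default [r] keeps this a probability law when there is no excess; guesses of positive
    probability then give it weight zero. *)
Definition residual p r a :=
  if excess p r == 0 then r a else Num.max 0 (r a - p a) / excess p r.

(* Conditional law of the final value given the guess [b]: the maximal
   coupling of [p] and [r]. *)
Definition couple p r b a :=
  (a == b)%:R * accept p r b + (1 - accept p r b) * residual p r a.

Definition mismatch p r := \sum_b p b * \sum_a couple p r b a * (a != b)%:R.

Lemma accept_bound p r b : pmf p -> pmf r -> 0 <= accept p r b <= 1.
Proof.
move=> [p0 _] [r0 _]; rewrite /accept le_min ler01 ge_min lexx andbT /=.
exact: divr_ge0.
Qed.

Lemma excess_ge0 p r : 0 <= excess p r.
Proof. by apply: sumr_ge0 => a _; rewrite le_max lexx. Qed.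

Lemma residual_pmf p r : pmf r -> pmf (residual p r).
Proof.
move=> [r0 r1]; rewrite /residual; case: eqVneq => [_|e0] //.
split=> [a|]; first by rewrite divr_ge0 ?excess_ge0 // le_max lexx.
by rewrite -mulr_suml divff.
Qed.

Lemma couple_pmf p r b : pmf p -> pmf r -> pmf (couple p r b).
Proof.
move=> pp pr; have /andP[a0 a1] := accept_bound b pp pr.
have [s0 s1] := residual_pmf p pr; split=> [a|].
  by rewrite addr_ge0 ?mulr_ge0 ?ler0n ?subr_ge0.
rewrite big_split -mulr_suml -mulr_sumr s1 mulr1 /=.
by rewrite (bigD1 b) //= eqxx big1 ?addr0 => [|a /negbTE->//]; rewrite mul1r; ring.
Qed.

Lemma mul_accept p r b : pmf p -> pmf r -> p b * accept p r b = Num.min (p b) (r b).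
Proof.
move=> [p0 _] [r0 _]; have [pb|pb] := eqVneq (p b) 0.
  by rewrite pb mul0r; apply/esym/min_idPl.
by rewrite /accept minr_pMr // mulr1 mulrCA divff // mulr1.
Qed.

Lemma sum_reject p r : pmf p -> pmf r ->
  \sum_b p b * (1 - accept p r b) = excess p r.
Proof.
move=> pp pr; under eq_bigr do rewrite mulrBr mulr1 mul_accept //.
rewrite sumrB pp.2 -pr.2 -sumrB; apply: eq_bigr => a _.
by rewrite -{1}(minD_max0 (p a) (r a)) addrC addKr.
Qed.

(** Accepted guesses contribute the minimum of [p] and [r]; the rejected mass equals the excess and
    is spread as the positive part of [r - p]. Together they make [r]. *)
Lemma couple_marginal p r a : pmf p -> pmf r -> \sum_b p b * couple p r b a = r a.
Proof.
move=> pp pr; under eq_bigr do rewrite mulrDr mulrA (mulrA (p _) (1 - _)).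
rewrite big_split /= -mulr_suml sum_reject // (bigD1 a) //= eqxx mulr1 mul_accept //.
rewrite big1 => [|b /negbTE]; last by rewrite eq_sym => ->; rewrite mulr0 mul0r.
rewrite addr0 /residual; case: eqVneq => [e0|e0].
  rewrite e0 mul0r addr0; move: (e0); rewrite /excess => /eqP; rewrite psumr_eq0;
    last by move=> b _; rewrite le_max lexx.
  move/allP/(_ a (mem_index_enum a)) => /=.
  rewrite eq_le ge_max lexx /= => /andP[rp _].
  have [||p_r] := ltgtP (p a) (r a); [lra | | by rewrite p_r].
  move=> rpa.
  (* equal total masses force [p = r] when no excess remains *)
  have := sum_reject pp pr; rewrite e0 => /eqP; rewrite psumr_eq0; last first.
    move=> b _; have /andP[_ a1] := accept_bound b pp pr.
    by rewrite mulr_ge0 ?subr_ge0 //; apply: pp.1.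
  move/allP/(_ a (mem_index_enum a)) => /=.
  by rewrite mulrBr mulr1 mul_accept // minElt ltNge (ltW rpa) /= subr_eq0 => /eqP; lra.
by rewrite mulrC divfK // minD_max0.
Qed.

(** A wrong guess requires a rejection. *)
Lemma mismatch_le p r : pmf p -> pmf r -> mismatch p r <= excess p r.
Proof.
move=> pp pr; rewrite -sum_reject //; apply: ler_sum => b _.
apply: ler_wpM2l; first exact: pp.1.
have /andP[_ a1] := accept_bound b pp pr.
have [s0 s1] := residual_pmf p pr.
rewrite -[leRHS]mulr1 -[X in _ <= _ * X]s1 mulr_sumr; apply: ler_sum => a _; rewrite /couple.
have h : 0 <= (1 - accept p r b) * residual p r a by rewrite mulr_ge0 ?subr_ge0.
by case: eqVneq => _ /=; rewrite ?mulr0 ?mulr1 ?mul0r ?add0r.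
Qed.

Lemma mismatch_ge0 p r : pmf p -> pmf r -> 0 <= mismatch p r.
Proof.
move=> pp pr; apply: sumr_ge0 => b _; rewrite mulr_ge0 ?pp.1 //.
by apply: sumr_ge0 => a _; rewrite mulr_ge0 ?ler0n //; have [->] := couple_pmf b pp pr.
Qed.

(** Averaging over the guess turns guessing and correcting into one exact draw from [r], plus a
    charge for the mismatch probability. *)
Lemma couple_step p r c f : pmf p -> pmf r ->
  \sum_b p b * \sum_a couple p r b a * (f a + c * (a != b)%:R) =
  c * mismatch p r + \sum_a r a * f a.
Proof.
move=> pp pr; under eq_bigr => b _.
  under eq_bigr do rewrite mulrDr mulrCA.
  rewrite big_split mulrDr -mulr_sumr mulrCA /=; over.
rewrite big_split /= -mulr_sumr addrC; congr (_ + _).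
under eq_bigr do rewrite mulr_sumr.
rewrite exchange_big; apply: eq_bigr => a _.
by rewrite -(couple_marginal a pp pr) mulr_suml; apply: eq_bigr => b _; rewrite mulrA.
Qed.

End Coupling.

(** * The sampler *)

Section Algorithm.
Variables (R : realType) (n q' : nat) (th : nat).
Let q := q'.+1.
Implicit Types (O : oracle R n q) (x : {ffun 'I_n -> option 'I_q}).
Implicit Types (js : seq 'I_n) (l : seq ('I_n * 'I_q)).

(** Answers given null events are arbitrary; replacing improper vectors by a point mass makes every
    kernel stochastic for every oracle. *)
Definition sane (v : {ffun 'I_q -> R}) : 'I_q -> R :=
  if [forall a, 0 <= v a] && (\sum_a v a == 1) then fun a => v a
  else fun a => (a == ord0)%:R.

Lemma sane_pmf v : pmf (sane v).
Proof.
rewrite /sane; case: ifP => [/andP[/forallP v0 /eqP v1] //|_]; split=> [a|].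
  exact: ler0n.
by rewrite (bigD1 ord0) //= ?eqxx big1 ?addr0 // => a /negbTE->.
Qed.

Lemma sane_id (v : {ffun 'I_q -> R}) : pmf v -> sane v = v.
Proof.
move=> [v0 v1]; rewrite /sane v1 eqxx andbT.
by have -> : [forall a, 0 <= v a] by apply/forallP.
Qed.

Definition ans O j x := sane (O (j, x)).

Definition upd x j a : {ffun 'I_n -> option 'I_q} :=
  [ffun i => if i == j then Some a else x i].

Fixpoint guess O x0 js : dist R (seq ('I_n * 'I_q)) :=
  if js is j :: js' then
    bind (draw (ans O j x0)) (fun b =>
      bind (guess O x0 js') (fun l => ret R ((j, b) :: l)))
  else ret R [::].

(* Confronts the guesses [l], made from the answers at [x0], with the answers at
   the growing assignment [x]; stops after correcting the first wrong guess and
   returns the positions left over. *)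
Fixpoint resolve O x0 x l : dist R ({ffun 'I_n -> option 'I_q} * seq 'I_n) :=
  if l is (j, b) :: l' then
    bind (draw (couple (ans O j x0) (ans O j x) b)) (fun a =>
      if a == b then resolve O x0 (upd x j a) l'
      else ret R (upd x j a, unzip1 l'))
  else ret R (x, [::]).

(** Each position is queried as if all earlier guesses were right, which suffices because [resolve]
    stops at the first wrong one. The answers at [x0] are requested again so that a step depends on
    the current round only. *)
Fixpoint checks x0 x l : seq (query n q) :=
  if l is (j, b) :: l' then (j, x0) :: (j, x) :: checks x0 (upd x j b) l'
  else [::].

(* [Open js x rest] asks for the marginals used to guess the block [js];
   [Check l x0 x rest] verifies the guesses [l] of a block opened at [x0]. *)
Inductive state :=
| Open of seq 'I_n & {ffun 'I_n -> option 'I_q} & seq (seq 'I_n)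
| Check of seq ('I_n * 'I_q) & {ffun 'I_n -> option 'I_q}
    & {ffun 'I_n -> option 'I_q} & seq (seq 'I_n).

(** Truncating at [th] bounds the queries at every state, reachable or not; [blocks] only produces
    lists that short. *)
Definition queries (s : state) : {set query n q} :=
  match s with
  | Open js x _ => [set qu in [seq (j, x) | j <- take th js]]
  | Check l x0 x _ => [set qu in checks x0 x (take th l)]
  end.

Definition output x : config n q := [ffun i => odflt ord0 (x i)].

Definition enter x (rest : seq (seq 'I_n)) : state + config n q :=
  if rest is js :: rest' then inl (Open js x rest') else inr (output x).

(** The leftover positions are guessed anew from answers at [x0] already received in this check, so
    a correction costs one further round and not two. *)
Definition resume O x0 x js rest : dist R (state + config n q) :=
  if nilp js then ret R (enter x rest)
  else bind (guess O x0 js) (fun l => ret R (inl (Check l x0 x rest))).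

Definition step O (s : state) : dist R (state + config n q) :=
  match s with
  | Open js x rest =>
      bind (guess O x (take th js)) (fun l => ret R (inl (Check l x x rest)))
  | Check l x0 x rest =>
      bind (resolve O x0 x (take th l)) (fun z => resume O x0 z.1 z.2 rest)
  end.

(** One block more than [n %/ th] covers all positions; the last one may be short or empty. *)
Definition blocks (s : 'S_n) : seq (seq 'I_n) :=
  reshape (nseq (n %/ th).+1 th) (codom s).

Definition unassigned : {ffun 'I_n -> option 'I_q} := [ffun=> None].

Definition start : dist R (state + config n q) :=
  bind (draw (fun _ : 'S_n => #|'S_n|%:R^-1))
       (fun s => ret R (enter unassigned (blocks s))).

Lemma guess_pmf O x0 js :
  dnonneg (guess O x0 js) /\ expect (guess O x0 js) (fun=> 1) = 1.
Proof.
elim: js => [|j js [IH0 IH1]] /=; first by rewrite dnonneg_ret expect_ret.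
have [p0 p1] := sane_pmf (O (j, x0)); split.
  apply: dnonneg_bind => [|b]; first exact: dnonneg_draw.
  by apply: dnonneg_bind => // l; apply: dnonneg_ret.
rewrite expect1_bind => [|b]; last by rewrite expect1_bind // => l; rewrite expect_ret.
by rewrite expect_draw; under eq_bigr do rewrite mulr1.
Qed.

Lemma resolve_pmf O x0 x l :
  dnonneg (resolve O x0 x l) /\ expect (resolve O x0 x l) (fun=> 1) = 1.
Proof.
elim: l x => [|[j b] l IH] x /=; first by rewrite dnonneg_ret expect_ret.
have [p0 p1] := couple_pmf b (sane_pmf (O (j, x0))) (sane_pmf (O (j, x))); split.
  apply: dnonneg_bind => [|a]; first exact: dnonneg_draw.
  by case: ifP => _; [have [] := IH (upd x j a) | apply: dnonneg_ret].
rewrite expect1_bind => [|a].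
  by rewrite expect_draw; under eq_bigr do rewrite mulr1.
by case: ifP => _; [have [] := IH (upd x j a) | rewrite expect_ret].
Qed.

Lemma resume_pmf O x0 x js rest :
  dnonneg (resume O x0 x js rest) /\ expect (resume O x0 x js rest) (fun=> 1) = 1.
Proof.
rewrite /resume; case: ifP => _; first by rewrite dnonneg_ret expect_ret.
have [g0 g1] := guess_pmf O x0 js; split.
  by apply: dnonneg_bind => // l; apply: dnonneg_ret.
by rewrite expect1_bind // => l; rewrite expect_ret.
Qed.

Lemma step_pmf O s : dnonneg (step O s) /\ expect (step O s) (fun=> 1) = 1.
Proof.
case: s => [js x rest|l x0 x rest] /=.
  have [g0 g1] := guess_pmf O x (take th js); split.
    by apply: dnonneg_bind => // l; apply: dnonneg_ret.
  by rewrite expect1_bind // => l; rewrite expect_ret.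
have [g0 g1] := resolve_pmf O x0 x (take th l); split.
  by apply: dnonneg_bind => // z; have [] := resume_pmf O x0 z.1 z.2 rest.
by rewrite expect1_bind // => z; have [] := resume_pmf O x0 z.1 z.2 rest.
Qed.

Lemma start_pmf : dnonneg start /\ expect start (fun=> 1) = 1.
Proof.
split.
  apply: dnonneg_bind => [|s]; last exact: dnonneg_ret.
  by apply: dnonneg_draw => s; rewrite invr_ge0 ler0n.
rewrite expect1_bind => [|s]; last by rewrite expect_ret.
rewrite expect_draw sumr_const mulr1 -[X in X *+ _]mul1r -mulrnAr -mulr_natl mul1r.
rewrite divff // pnatr_eq0 -lt0n; apply/card_gt0P; exists 1%g.
by [].
Qed.

Lemma expect_guess O x0 j js f :
  expect (guess O x0 (j :: js)) f =
  \sum_b ans O j x0 b * expect (guess O x0 js) (fun l => f ((j, b) :: l)).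
Proof.
rewrite /= expect_bind expect_draw; apply: eq_bigr => b _; congr (_ * _).
by rewrite expect_bind; apply: eq_expect => l; rewrite expect_ret.
Qed.

Lemma eq_expect_guess O O' x0 js f g :
  {in js, forall j, O (j, x0) = O' (j, x0)} ->
  (forall l, unzip1 l = js -> f l = g l) ->
  expect (guess O x0 js) f = expect (guess O' x0 js) g.
Proof.
elim: js f g => [|j js IH] f g OO' fg; first by rewrite !expect_ret fg.
rewrite !expect_guess; apply: eq_bigr => b _.
rewrite /ans OO' ?mem_head //; congr (_ * _); apply: IH => [i ijs|l l_js].
  by rewrite OO' // in_cons ijs orbT.
by rewrite fg //= l_js.
Qed.

Lemma expect_resolve O x0 x j b l f :
  expect (resolve O x0 x ((j, b) :: l)) f =
  \sum_a couple (ans O j x0) (ans O j x) b a *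
    (if a == b then expect (resolve O x0 (upd x j a) l) f
     else f (upd x j a, unzip1 l)).
Proof.
rewrite /= expect_bind expect_draw; apply: eq_bigr => a _; congr (_ * _).
by case: ifP => // _; rewrite expect_ret.
Qed.

Lemma eq_expect_resolve O O' x0 x l f g :
  {in checks x0 x l, O =1 O'} ->
  (forall z, {subset z.2 <= unzip1 l} -> (size z.2 <= size l)%N -> f z = g z) ->
  expect (resolve O x0 x l) f = expect (resolve O' x0 x l) g.
Proof.
elim: l x => [|[j b] l IH] x OO' fg; first by rewrite !expect_ret fg.
rewrite !expect_resolve; apply: eq_bigr => a _.
rewrite /ans !OO' ?in_cons ?eqxx ?orbT //; congr (_ * _).
case: eqP => [->|_].
  apply: IH => [qu quc|z zl zs]; first by rewrite OO' // !in_cons quc !orbT.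
  by apply: fg => [i /zl il|] /=; [rewrite in_cons il orbT | apply: leqW].
apply: fg => /= [i il|]; first by rewrite in_cons il orbT.
by rewrite size_map.
Qed.

Lemma size_checks x0 x l : size (checks x0 x l) = (2 * size l)%N.
Proof. by elim: l x => [//|[j b] l IH] x /=; rewrite IH mulnS. Qed.

Lemma mem_checks x0 x l j : j \in unzip1 l -> (j, x0) \in checks x0 x l.
Proof.
elim: l x => [//|[i b] l IH] x /=; rewrite !in_cons => /orP[/eqP->|jl].
  by rewrite eqxx.
by rewrite IH // !orbT.
Qed.

Lemma card_queries s : (#|queries s| <= 2 * th)%N.
Proof.
have card_seq (r : seq (query n q)) : (size r <= 2 * th)%N ->
    (#|[set qu in r]| <= 2 * th)%N.
  by move=> rs; rewrite cardsE (leq_trans (card_size r)).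
case: s => [js x rest|l x0 x rest] /=; apply: card_seq.
  by rewrite size_map size_take_min (leq_trans (geq_minl _ _)) // leq_pmull.
by rewrite size_checks leq_mul2l size_take_min geq_minl.
Qed.

Lemma resume_local O O' x0 x js rest f :
  {in js, forall j, O (j, x0) = O' (j, x0)} ->
  expect (resume O x0 x js rest) f = expect (resume O' x0 x js rest) f.
Proof.
move=> OO'; rewrite /resume; case: ifP => // _.
by rewrite !expect_bind; apply: eq_expect_guess.
Qed.

Lemma step_local O O' s : {in queries s, O =1 O'} ->
  forall f, expect (step O s) f = expect (step O' s) f.
Proof.
case: s => [js x rest|l x0 x rest] /= OO' f; rewrite !expect_bind.
  by apply: eq_expect_guess => // j jjs; apply: OO'; rewrite inE map_f.
apply: eq_expect_resolve => [qu quc|z zl _]; first by apply: OO'; rewrite inE.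
apply: resume_local => j /zl jl; apply: OO'.
by rewrite inE mem_checks.
Qed.

(** * Exact accounting of rounds and output *)

Variables (c : R) (g : config n q -> R).

(* Fresh samples from the answers at [x], each charged [c] times the
   probability that its guess from [x0] would have been wrong.  A wrong last
   guess of a block is free: no further round is needed to finish the block. *)
Fixpoint run O x0 js x (k : {ffun 'I_n -> option 'I_q} -> R) : R :=
  if js is j :: js' then
    c * (js' != [::])%:R * mismatch (ans O j x0) (ans O j x)
    + \sum_a ans O j x a * run O x0 js' (upd x j a) k
  else k x.

(** The charge [2 * c] pays for opening a block and for its first check; every further check is paid
    by the correction that causes it. *)
Fixpoint remaining O (rest : seq (seq 'I_n)) x : R :=
  if rest is js :: rest' then 2 * c + run O x (take th js) x (remaining O rest')
  else g (output x).

Definition resumed O x0 rest (z : {ffun 'I_n -> option 'I_q} * seq 'I_n) :=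
  if nilp z.2 then remaining O rest z.1 else c + run O x0 z.2 z.1 (remaining O rest).

Definition potential O (s : state) : R :=
  match s with
  | Open js x rest => remaining O (js :: rest) x
  | Check l x0 x rest => c + expect (resolve O x0 x (take th l)) (resumed O x0 rest)
  end.

(** Later guesses are independent of the fate of the current one: after a match they are still
    fresh, after a mismatch they are redrawn from the same law. Hence mismatch probabilities do not
    depend on where earlier corrections fell. *)
Lemma expect_guess_resolve O x0 js x rest :
  expect (guess O x0 js) (fun l => expect (resolve O x0 x l) (resumed O x0 rest)) =
  run O x0 js x (remaining O rest).
Proof.
elim: js x => [|j js IH] x; first by rewrite !expect_ret.
rewrite expect_guess /= -couple_step; try exact: sane_pmf.
apply: eq_bigr => b _; congr (_ * _).
under eq_expect do rewrite expect_resolve.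
rewrite expect_sum; apply: eq_bigr => a _; rewrite expectZ; congr (_ * _).
case: eqP => _ /=; first by rewrite IH mulr0 addr0.
(* After a mismatch only the positions of the later guesses matter; their values integrate to
   one. *)
rewrite (eq_expect_guess (O' := O) (g := fun=> resumed O x0 rest (upd x j a, js))) //; last first.
  by move=> l ->.
rewrite expect_cst (guess_pmf O x0 js).2 mulr1 mulr1 /resumed /=.
by case: js {IH} => [|i js] /=; rewrite ?mulr0 ?addr0 // mulr1 addrC.
Qed.

Lemma potential_resume O x0 x js rest : (size js <= th)%N ->
  expect (resume O x0 x js rest) (value g (potential O)) = resumed O x0 rest (x, js).
Proof.
move=> js_th; rewrite /resume /resumed /=; case: ifP => _.
  by rewrite expect_ret; case: rest.
rewrite expect_bind -expect_guess_resolve.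
rewrite -[c]mulr1 -(guess_pmf O x0 js).2 -expect_cst -expectD.
apply: eq_expect_guess => // l l_js; rewrite expect_ret /= take_oversize //.
by rewrite -(size_map fst) [map _ _]l_js.
Qed.

Lemma potential_step O s :
  potential O s = c + expect (step O s) (value g (potential O)).
Proof.
case: s => [js x rest|l x0 x rest] /=.
  rewrite -expect_guess_resolve mulr_natl mulr2n -addrA; congr (_ + _).
  rewrite -[c]mulr1 -(guess_pmf O x (take th js)).2 -expect_cst -expectD expect_bind.
  apply: eq_expect_guess => // l l_js; rewrite expect_ret /= take_oversize //.
  by rewrite -(size_map fst) [map _ _]l_js size_take_min geq_minl.
rewrite expect_bind; congr (_ + _); apply: eq_expect_resolve => // z _ zs.
by rewrite potential_resume -?surjective_pairing // (leq_trans zs) // size_take_min geq_minl.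
Qed.

Lemma potential_start O : expect start (value g (potential O)) =
  #|'S_n|%:R^-1 * \sum_(s : 'S_n) remaining O (blocks s) unassigned.
Proof.
rewrite expect_bind expect_draw -mulr_sumr; congr (_ * _).
by apply: eq_bigr => s _; rewrite expect_ret; case: (blocks s).
Qed.

Lemma run_ge0 O x0 js x k : 0 <= c -> (forall y, 0 <= k y) ->
  0 <= run O x0 js x k.
Proof.
move=> c0 k0; elim: js x => [|j js IH] x //=; rewrite addr_ge0 //.
  by rewrite !mulr_ge0 ?ler0n // mismatch_ge0 //; apply: sane_pmf.
by apply: sumr_ge0 => a _; rewrite mulr_ge0 //; exact: (sane_pmf _).1.
Qed.

Lemma remaining_ge0 O rest x : 0 <= c -> (forall y, 0 <= g y) -> 0 <= remaining O rest x.
Proof.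
move=> c0 g0; elim: rest x => [|js rest IH] x //=.
by rewrite addr_ge0 ?mulr_ge0 ?run_ge0.
Qed.

Lemma potential_ge0 O s : 0 <= c -> (forall y, 0 <= g y) -> 0 <= potential O s.
Proof.
move=> c0 g0; case: s => [js x rest|l x0 x rest]; first exact: remaining_ge0.
rewrite addr_ge0 // expect_ge0 //; first exact: (resolve_pmf _ _ _ _).1.
move=> z; rewrite /resumed; case: ifP => _; first exact: remaining_ge0.
by rewrite addr_ge0 // run_ge0 // => y; apply: remaining_ge0.
Qed.

End Algorithm.

(** * Divergence and entropy *)

Section Divergence.
Variable R : realType.

Lemma ln_le_sub1 (x : R) : 0 < x -> ln x <= x - 1.
Proof.
move=> x0; rewrite -[X in ln X](_ : 1 + (x - 1) = x); last by ring.
by apply: le_ln1Dx; lra.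
Qed.

Lemma ln_sub_ge (p r : R) : 0 < p -> 0 < r -> r - p <= r * (ln r - ln p).
Proof.
move=> p0 r0; have pr0 : 0 < p / r by rewrite divr_gt0.
have := ln_le_sub1 pr0.
rewrite ln_div ?posrE // => h.
have -> : r - p = r * (1 - p / r) by rewrite mulrBr mulr1 mulrCA divff ?mulr1 // gt_eqF.
by rewrite ler_pM2l //; lra.
Qed.

(* With [v = 1 - sqrt (p / r)], the left side is at most [2 r v] and the last
   bracket is at least [r v ^ 2]. *)
Lemma excess_term (p r t : R) : 0 <= p -> 0 <= r -> (0 < r -> 0 < p) -> 0 < t ->
  Num.max 0 (r - p) <= r * t + (r * (ln r - ln p) + p - r) / t.
Proof.
move=> p0 r0 rp t0; have [r_eq|rn0] := eqVneq r 0.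
  rewrite r_eq !mul0r !add0r subr0 max_l; last by lra.
  by rewrite divr_ge0 // ltW.
have {}r0 : 0 < r by rewrite lt_def rn0.
have {}p0 : 0 < p := rp r0.
set s := Num.sqrt (p / r); have pr0 : 0 < p / r by rewrite divr_gt0.
have s0 : 0 < s by rewrite sqrtr_gt0.
have pE : p = r * s ^+ 2 by rewrite sqr_sqrtr ?ltW // mulrCA divff // mulr1.
have lns := ln_le_sub1 s0.
have lnE : ln r - ln p = - (2 * ln s).
  rewrite pE lnM ?posrE ?exprn_gt0 // lnXn // mulr_natl; lra.
rewrite lnE pE.
have lb : r * (1 - s) ^+ 2 / t <= (r * - (2 * ln s) + r * s ^+ 2 - r) / t.
  rewrite ler_pM2r ?invr_gt0 //.
  have -> : r * - (2 * ln s) + r * s ^+ 2 - r = r * (- (2 * ln s) + s ^+ 2 - 1) by ring.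
  by rewrite ler_pM2l //; nra.
apply: le_trans (lerD (lexx _) lb).
have -> : r * t + r * (1 - s) ^+ 2 / t = r * (t + (1 - s) ^+ 2 / t) by ring.
have -> : r - r * s ^+ 2 = r * (1 - s ^+ 2) by ring.
rewrite ge_max; apply/andP; split.
  by rewrite mulr_ge0 ?ltW // ltr_wpDr // divr_ge0 ?sqr_ge0 // ltW.
rewrite ler_pM2l //.
have : 0 <= (t - (1 - s)) ^+ 2 / t by rewrite divr_ge0 ?sqr_ge0 // ltW.
have -> : (t - (1 - s)) ^+ 2 / t = t - 2 * (1 - s) + (1 - s) ^+ 2 / t.
  by field; rewrite gt_eqF.
by have := sqr_ge0 (1 - s); nra.
Qed.

(** A linearised Pinsker-type bound: summed over [a], the terms [p a - r a] cancel. *)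
Lemma excess_le (I : finType) (p r : I -> R) (t : R) : pmf p -> pmf r ->
  (forall a, 0 < r a -> 0 < p a) -> 0 < t ->
  excess p r <= t + (\sum_a r a * (ln (r a) - ln (p a))) / t.
Proof.
move=> [p0 p1] [r0 r1] rp t0.
have -> : t + (\sum_a r a * (ln (r a) - ln (p a))) / t =
    \sum_a (r a * t + (r a * (ln (r a) - ln (p a)) + p a - r a) / t).
  rewrite big_split -!mulr_suml r1 mul1r sumrB big_split /= p1 r1.
  by rewrite -addrA subrr addr0.
by apply: ler_sum => a _; apply: excess_term; auto.
Qed.

Lemma divergence_ge0 (I : finType) (p r : I -> R) : pmf p -> pmf r ->
  (forall a, 0 < r a -> 0 < p a) -> 0 <= \sum_a r a * (ln (r a) - ln (p a)).
Proof.
move=> [p0 p1] [r0 r1] rp.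
rewrite -[leLHS](_ : \sum_a (r a - p a) = 0); last by rewrite sumrB p1 r1 subrr.
apply: ler_sum => a _; have [ra|ra] := eqVneq (r a) 0.
  by rewrite ra mul0r sub0r oppr_le0.
have r_gt0 : 0 < r a by rewrite lt_def ra r0.
by apply: ln_sub_ge; auto.
Qed.

End Divergence.

(** * Cost of a fixed order in terms of entropy increments *)

Section Budget.
Variables (R : realType) (n : nat) (h : {set 'I_n} -> R) (th : nat).
Implicit Types (A : {set 'I_n}) (js : seq 'I_n).

(** For an entropy [h], the total expected divergence along the block: the increments over the
    growing set telescope to the subtracted term. *)
Definition loss A0 A js := \sum_(j <- js) (h (j |: A0) - h A0)
  - (h (A :|: [set i in js]) - h A).

(** The [3] is two rounds to open and check, plus at most [th] positions at [t = 1 / th] each;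
    dividing divergences by [t] gives the factor [th]. *)
Fixpoint budget A (rest : seq (seq 'I_n)) : R :=
  if rest is js :: rest' then
    3 + th%:R * loss A A js + budget (A :|: [set i in js]) rest'
  else 0.

End Budget.

Section Tower.
Variables (R : realType) (n q' : nat).
Let q := q'.+1.
Variables (mu : {ffun config n q -> R}) (O : oracle R n q).
Hypothesis mu_dist : is_distribution mu.
Hypothesis O_cm : is_cm_oracle mu O.
Implicit Types (A : {set 'I_n}) (y : config n q) (j : 'I_n).

Definition restr A y : {ffun 'I_n -> option 'I_q} :=
  [ffun i => if i \in A then Some (y i) else None].

Lemma agrees_restr A y z : agrees (restr A y) z = (restr A z == restr A y).
Proof.
apply/forallP/eqP => [yz|yz i].
  by apply/ffunP => i; have := yz i; rewrite !ffunE; case: ifP => // _ /eqP->.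
by have := congr1 (fun f : {ffun _ -> _} => f i) yz; rewrite !ffunE; case: ifP => // _ [->].
Qed.

Lemma upd_restr A y j : upd (restr A y) j (y j) = restr (j |: A) y.
Proof.
by apply/ffunP => i; rewrite !ffunE in_setU1; case: eqP => [->|].
Qed.

Lemma output_restr y : output (restr setT y) = y.
Proof. by apply/ffunP => i; rewrite !ffunE inE. Qed.

Definition marg A y := cond_prob mu (restr A y).

Lemma marg_gt0 A y : 0 < mu y -> 0 < marg A y.
Proof.
move=> y0; rewrite /marg /cond_prob (bigD1 y) ?agrees_restr //=.
by rewrite ltr_wpDr // sumr_ge0 // => z _; apply: mu_dist.1.
Qed.

Lemma joint_marg A y j : joint_prob mu j (restr A y) (y j) = marg (j |: A) y.
Proof.
apply: eq_bigl => z; rewrite !agrees_restr; apply/andP/eqP => [[/eqP zy /eqP zj]|zy].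
  apply/ffunP => i; rewrite !ffunE in_setU1; case: eqP => [->|_] /=; first by rewrite zj.
  by have := congr1 (fun f : {ffun _ -> _} => f i) zy; rewrite !ffunE.
split.
  apply/eqP/ffunP => i; have := congr1 (fun f : {ffun _ -> _} => f i) zy.
  by rewrite !ffunE in_setU1; case: (i \in A); rewrite ?orbT.
have := congr1 (fun f : {ffun _ -> _} => f j) zy.
by rewrite !ffunE setU11 => -[->].
Qed.

Lemma ansE A y j : 0 < mu y ->
  ans O j (restr A y) =1 fun a => joint_prob mu j (restr A y) a / marg A y.
Proof.
move=> y0 a; have m0 := marg_gt0 A y0.
have OE := O_cm (qu := (j, restr A y)) m0.
rewrite /ans sane_id ?OE //; split=> [b|]; rewrite ?OE /=.
  by apply: divr_ge0; [apply: sumr_ge0 => z _; apply: mu_dist.1 | exact: ltW].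
under eq_bigr do rewrite OE.
rewrite -mulr_suml -[X in X / _](_ : marg A y = _) ?divff ?gt_eqF //=.
rewrite /marg /cond_prob (partition_big (fun z : config n q => z j) xpredT) //=.
Qed.

Lemma ans_own A y j : 0 < mu y ->
  ans O j (restr A y) (y j) = marg (j |: A) y / marg A y.
Proof. by move=> y0; rewrite ansE // joint_marg. Qed.

(* The own coordinate of [y ~ mu] is distributed as the answer given [y_A]. *)
Lemma tower A j (G : 'I_q -> {ffun 'I_n -> option 'I_q} -> R) :
  \sum_y mu y * \sum_a ans O j (restr A y) a * G a (restr A y) =
  \sum_y mu y * G (y j) (restr A y).
Proof.
(* The answer is expanded over a second sample [z] agreeing with [y] on [A]; summing over [y] first
   then cancels the normalisation. *)
have swap y : mu y * \sum_a ans O j (restr A y) a * G a (restr A y) =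
    \sum_z (restr A z == restr A y)%:R *
           (mu y / marg A y * (mu z * G (z j) (restr A z))).
  have := mu_dist.1 y; rewrite le_eqVlt => /orP[/eqP <-|y0].
    by rewrite mul0r big1 // => z _; rewrite !mul0r mulr0.
  transitivity (mu y / marg A y *
      \sum_(z | agrees (restr A y) z) mu z * G (z j) (restr A z)).
    rewrite (partition_big (fun z : config n q => z j) xpredT) //= !mulr_sumr.
    apply: eq_bigr => a _; rewrite ansE // (eq_bigr (fun z => mu z * G a (restr A y))).
      by rewrite -mulr_suml /joint_prob; ring.
    by move=> z /andP[]; rewrite agrees_restr => /eqP-> /eqP->.
  rewrite mulr_sumr big_mkcond; apply: eq_bigr => z _.
  by rewrite agrees_restr; case: ifP; rewrite ?mul1r ?mul0r.
under eq_bigr do rewrite swap.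
rewrite exchange_big; apply: eq_bigr => z _ /=.
have := mu_dist.1 z; rewrite le_eqVlt => /orP[/eqP <-|z0].
  by rewrite mul0r big1 // => y _; rewrite !(mul0r, mulr0).
rewrite (eq_bigr (fun y => (restr A y == restr A z)%:R * mu y *
                           ((marg A z)^-1 * (mu z * G (z j) (restr A z))))); last first.
  move=> y _; rewrite eq_sym /marg; case: eqP => [->|_]; last by rewrite !mul0r.
  by rewrite !mul1r -mulrA.
rewrite -mulr_suml (_ : \sum_y _ = marg A z); last first.
  rewrite /marg /cond_prob [RHS]big_mkcond; apply: eq_bigr => y _.
  by rewrite agrees_restr; case: ifP; rewrite ?mul1r ?mul0r.
by rewrite mulrA divff ?mul1r // gt_eqF ?marg_gt0.
Qed.

Definition entropy A := - \sum_y mu y * ln (marg A y).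

(** Recovers the assignment at the opening of a block from the current one, so that expressions in
    both have the form required by [tower]. *)
Definition mask A (x : {ffun 'I_n -> option 'I_q}) : {ffun 'I_n -> option 'I_q} :=
  [ffun i => if i \in A then x i else None].

Lemma mask_restr A0 A y : A0 \subset A -> mask A0 (restr A y) = restr A0 y.
Proof.
move=> A0A; apply/ffunP => i; rewrite !ffunE.
by case: ifP => // iA0; rewrite (fintype.subsetP A0A).
Qed.

Lemma agrees_subset A0 A y z : A0 \subset A ->
  agrees (restr A y) z -> agrees (restr A0 y) z.
Proof.
by move=> A0A; rewrite !agrees_restr -!(mask_restr _ A0A) => /eqP->.
Qed.

(** The absolute continuity required by [excess_le] and [divergence_ge0]. *)
Lemma ans_gt0_subset A0 A y j a : A0 \subset A -> 0 < mu y ->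
  0 < ans O j (restr A y) a -> 0 < ans O j (restr A0 y) a.
Proof.
move=> A0A y0; rewrite !ansE // !pmulr_lgt0 ?invr_gt0 ?marg_gt0 //.
move=> /lt_le_trans; apply; rewrite /joint_prob [leRHS](bigID (agrees (restr A y))) /=.
rewrite [leLHS](eq_bigl (fun z => (agrees (restr A0 y) z && (z j == a)) && agrees (restr A y) z)).
  by rewrite lerDl sumr_ge0 // => z _; apply: mu_dist.1.
move=> z; case: (boolP (agrees (restr A y) z)) => [yz|_]; last by rewrite andbF.
by rewrite (agrees_subset A0A yz) andbT.
Qed.

Lemma sum_ln_own A j : \sum_y mu y * ln (ans O j (restr A y) (y j)) =
  entropy A - entropy (j |: A).
Proof.
rewrite /entropy opprK addrC -sumrB; apply: eq_bigr => y _.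
have := mu_dist.1 y; rewrite le_eqVlt => /orP[/eqP <-|y0]; first by rewrite !mul0r subrr.
by rewrite ans_own // ln_div ?posrE ?marg_gt0 // mulrBr.
Qed.

(** By [tower] both logarithms are evaluated at the own coordinate of [y], where the chain rule
    makes them entropy increments. *)
Lemma divergence_entropy A0 A j : A0 \subset A ->
  \sum_y mu y * \sum_a ans O j (restr A y) a *
     (ln (ans O j (restr A y) a) - ln (ans O j (restr A0 y) a)) =
  (entropy (j |: A0) - entropy A0) - (entropy (j |: A) - entropy A).
Proof.
move=> A0A.
have := tower A j (fun a x => ln (ans O j x a) - ln (ans O j (mask A0 x) a)).
under eq_bigr do under eq_bigr do rewrite mask_restr //.
move=> ->; under eq_bigr do rewrite mask_restr // mulrBr.
by rewrite sumrB !sum_ln_own; lra.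
Qed.

(** The gap is an expected divergence. *)
Lemma entropy_submodular A i j :
  entropy (j |: (i |: A)) - entropy (i |: A) <= entropy (j |: A) - entropy A.
Proof.
rewrite -subr_ge0 -divergence_entropy ?subsetUr //.
apply: sumr_ge0 => y _; have := mu_dist.1 y; rewrite le_eqVlt => /orP[/eqP <-|y0].
  by rewrite mul0r.
rewrite mulr_ge0 ?(ltW y0) // divergence_ge0 //; try exact: sane_pmf.
by move=> a; apply: ans_gt0_subset; rewrite ?subsetUr.
Qed.

Lemma entropy_mono A j : entropy A <= entropy (j |: A).
Proof.
rewrite lerN2; apply: ler_sum => y _.
have := mu_dist.1 y; rewrite le_eqVlt => /orP[/eqP <-|y0]; first by rewrite !mul0r.
rewrite ler_pM2l // ler_ln ?posrE ?marg_gt0 // -joint_marg.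
rewrite /joint_prob /marg /cond_prob big_mkcondr; apply: ler_sum => z _.
by case: ifP => // _; apply: mu_dist.1.
Qed.

(** Nonnegativity of the divergence from the uniform law. *)
Lemma entropy_cap A j : entropy (j |: A) - entropy A <= ln q%:R.
Proof.
rewrite -opprB -sum_ln_own lerNl -[leLHS]mulr1 -[X in _ * X <= _]mu_dist.2 mulr_sumr.
rewrite -(tower A j (fun a x => ln (ans O j x a))); apply: ler_sum => y _.
rewrite mulrC ler_wpM2l //.
  exact: mu_dist.1.
have r_pmf : pmf (ans O j (restr A y)) by apply: sane_pmf.
have u_pmf : pmf (fun _ : 'I_q => q%:R^-1 : R).
  split=> [_|]; first by rewrite invr_ge0 ler0n.
  by rewrite sumr_const card_ord -[LHS]mulr_natl divff // pnatr_eq0.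
have := divergence_ge0 u_pmf r_pmf (fun _ _ => _); rewrite invr_gt0 ltr0n => /(_ (fun=> isT)).
under eq_bigr do rewrite lnV ?posrE ?ltr0n // opprK mulrDr.
by rewrite big_split /= -mulr_suml r_pmf.2 mul1r; lra.
Qed.

Lemma expected_mismatch A0 A j t : A0 \subset A -> 0 < t ->
  \sum_y mu y * mismatch (ans O j (restr A0 y)) (ans O j (restr A y)) <=
  t + ((entropy (j |: A0) - entropy A0) - (entropy (j |: A) - entropy A)) / t.
Proof.
move=> A0A t0; rewrite -divergence_entropy // -[X in _ <= X + _]mulr1.
rewrite -[X in _ <= _ * X + _]mu_dist.2 mulr_sumr mulr_suml -big_split; apply: ler_sum => y _ /=.
have := mu_dist.1 y; rewrite le_eqVlt => /orP[/eqP <-|y0].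
  by rewrite !mul0r mulr0 addr0.
rewrite [t * _]mulrC -mulrA -mulrDr ler_pM2l //.
apply: le_trans (mismatch_le _ _) _; try exact: sane_pmf.
apply: excess_le => //; try exact: sane_pmf.
by move=> a; apply: ans_gt0_subset.
Qed.

(** The fresh draw is replaced by the own coordinate of [y], so the assignment remains a restriction
    of [y] and induction applies. *)
Lemma run_cons c A0 A j js k : A0 \subset A ->
  \sum_y mu y * run c O (restr A0 y) (j :: js) (restr A y) k =
  c * (js != [::])%:R *
    \sum_y mu y * mismatch (ans O j (restr A0 y)) (ans O j (restr A y))
  + \sum_y mu y * run c O (restr A0 y) js (restr (j |: A) y) k.
Proof.
move=> A0A /=; under eq_bigr do rewrite mulrDr mulrCA.
rewrite big_split -mulr_sumr; congr (_ + _).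
transitivity (\sum_y mu y * run c O (mask A0 (restr A y)) js (upd (restr A y) j (y j)) k).
  rewrite -(tower A j (fun a x => run c O (mask A0 x) js (upd x j a) k)).
  apply: eq_bigr => y _; congr (_ * _); apply: eq_bigr => a _.
  by rewrite mask_restr.
by apply: eq_bigr => y _; rewrite mask_restr // upd_restr.
Qed.

Lemma setU_cons A j js :
  A :|: [set i in j :: js] = (j |: A) :|: [set i in js].
Proof.
by apply/setP => i; rewrite !inE orbA (orbC (i \in A)).
Qed.

Lemma setU_nil A : A :|: [set i in [::]] = A.
Proof. by apply/setP => i; rewrite !inE orbF. Qed.

Lemma run_free A0 A js k : A0 \subset A ->
  \sum_y mu y * run 0 O (restr A0 y) js (restr A y) k =
  \sum_y mu y * k (restr (A :|: [set i in js]) y).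
Proof.
elim: js A => [|j js IH] A A0A; first by rewrite setU_nil.
rewrite run_cons // !mul0r add0r IH ?setU_cons //.
exact: fintype.subset_trans (subsetUr _ _).
Qed.

Lemma run_bound A0 A js k t : A0 \subset A -> 0 < t ->
  \sum_y mu y * run 1 O (restr A0 y) js (restr A y) k <=
  t * (size js)%:R + loss entropy A0 A js / t
  + \sum_y mu y * k (restr (A :|: [set i in js]) y).
Proof.
move=> + t0; elim: js A => [|j js IH] A A0A.
  by rewrite /loss setU_nil big_nil !subrr mulr0 mul0r !add0r.
have A0jA : A0 \subset j |: A by apply: fintype.subset_trans (subsetUr _ _).
rewrite run_cons // setU_cons mul1r.
apply: le_trans (lerD (_ : _ <= t +
   ((entropy (j |: A0) - entropy A0) - (entropy (j |: A) - entropy A)) / t) (IH _ A0jA)) _.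
  apply: le_trans (expected_mismatch j A0A t0).
  rewrite ler_piMl // ?lern1 ?leq_b1 // sumr_ge0 // => y _.
  by rewrite mulr_ge0 ?mu_dist.1 // mismatch_ge0 //; apply: sane_pmf.
rewrite /loss big_cons setU_cons /= -natr1.
by rewrite le_eqVlt; apply/orP; left; apply/eqP; ring.
Qed.

Variable th : nat.

Lemma remaining_law g A rest : all (fun js => size js <= th)%N rest ->
  \sum_y mu y * remaining th 0 g O rest (restr A y) =
  \sum_y mu y * g (output (restr (A :|: [set i in flatten rest]) y)).
Proof.
elim: rest A => [|js rest IH] A; first by rewrite setU_nil.
move=> /= /andP[js_th rest_th]; rewrite mulr0.
under eq_bigr do rewrite add0r take_oversize //.
rewrite run_free // IH //; apply: eq_bigr => y _; congr (_ * g (output (restr _ y))).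
by apply/setP => i; rewrite !inE mem_cat orbA.
Qed.

Lemma remaining_bound A rest : (0 < th)%N -> all (fun js => size js <= th)%N rest ->
  \sum_y mu y * remaining th 1 (fun=> 0) O rest (restr A y) <= budget entropy th A rest.
Proof.
move=> th0; elim: rest A => [|js rest IH] A /=.
  by under eq_bigr do rewrite mulr0; rewrite big1.
move=> /andP[js_th rest_th].
under eq_bigr do rewrite mulrDr take_oversize //.
rewrite big_split -mulr_suml mu_dist.2 mul1r mulr1 /=.
have t0 : 0 < th%:R^-1 :> R by rewrite invr_gt0 ltr0n.
have := run_bound js (remaining th 1 (fun=> 0) O rest) (subxx A) t0.
rewrite invrK => rb; have := IH (A :|: [set i in js]) rest_th => tb.
have : th%:R^-1 * (size js)%:R <= 1 :> R.
  by rewrite mulrC ler_pdivrMr ?ltr0n // mul1r ler_nat.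
by rewrite (mulrC th%:R); lra.
Qed.

End Tower.

(** * Averaging over the order *)

Section Averaging.
Variables (R : realType) (n : nat) (h : {set 'I_n} -> R).
Implicit Types (s : 'S_n).

Hypothesis h_submod : forall A i j,
  h (j |: (i |: A)) - h (i |: A) <= h (j |: A) - h A.
Hypothesis h_mono : forall A j, h A <= h (j |: A).

Definition initial k s := [set j in take k (codom s)].

Lemma initialE k s : initial k s = s @: [set i : 'I_n | (i < k)%N].
Proof.
have mem_enum_take (i : 'I_n) : (i \in take k (enum 'I_n)) = (i < k)%N.
  rewrite -(mem_map val_inj) map_take val_enum_ord take_iota mem_iota /=.
  by rewrite add0n leq_min ltn_ord andbT.
apply/setP => j; rewrite inE codomE -map_take; apply/mapP/imsetP => -[i].
  by rewrite mem_enum_take => ik ->; exists i; rewrite ?inE.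
by rewrite inE => ik ->; exists i; rewrite ?mem_enum_take.
Qed.

Lemma initialS (k : 'I_n) s : initial k.+1 s = s k |: initial k s.
Proof.
rewrite !initialE; have -> : [set i : 'I_n | (i < k.+1)%N] = k |: [set i : 'I_n | (i < k)%N].
  by apply/setP => i; rewrite !inE ltnS leq_eqVlt.
by rewrite imsetU1.
Qed.

Definition avg k := \sum_(s : 'S_n) h (initial k s).

Definition gain k := avg k.+1 - avg k.

Lemma initial_full k s : (n <= k)%N -> initial k s = initial n s.
Proof. by move=> nk; rewrite /initial !take_oversize // size_codom card_ord. Qed.

(** Lets short or empty last blocks obey the same formulas as full ones. *)
Lemma gain_full k : (n <= k)%N -> gain k = 0.
Proof.
move=> nk; rewrite /gain -sumrB big1 // => s _.
by rewrite !(initial_full s (k := _)) ?subrr // leqW.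
Qed.

(* Exchangeability of the positions of a uniform order. *)
Lemma avg_insert k (m : 'I_n) : (k <= m)%N ->
  \sum_(s : 'S_n) h (s m |: initial k s) = avg k.+1.
Proof.
move=> km; pose k' := Ordinal (leq_ltn_trans km (ltn_ord m)).
(* Swapping positions [k] and [m] leaves the positions before [k] in place. *)
rewrite /avg (reindex_inj (mulgI (tperm k' m))); apply: eq_bigr => s _ /=.
rewrite -[k in k.+1]/(val k') initialS permM tpermR; congr (h (_ |: _)).
rewrite !initialE; apply: eq_in_imset => i; rewrite inE => ik.
rewrite permM tpermD // -val_eqE /= ?gtn_eqF //.
exact: leq_trans ik km.
Qed.

Lemma gain_ge0 k : 0 <= gain k.
Proof.
have [kn|nk] := ltnP k n; last by rewrite gain_full.
rewrite /gain -sumrB; apply: sumr_ge0 => s _.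
by rewrite (initialS (Ordinal kn)) subr_ge0.
Qed.

(** By exchangeability the increment at [k] may add the element in position [k.+1]; both increments
    then add the same element to nested sets. *)
Lemma gain_decr k : gain k.+1 <= gain k.
Proof.
have [kn|nk] := ltnP k.+1 n; last by rewrite gain_full ?gain_ge0.
have kn' := ltnW kn.
rewrite /gain -{2}(avg_insert (k := k) (m := Ordinal kn)) //= /avg -!sumrB; apply: ler_sum => s _.
by rewrite (initialS (Ordinal kn)) /= (initialS (Ordinal kn')).
Qed.

Lemma gain_anti a b : (a <= b)%N -> gain b <= gain a.
Proof.
move=> /subnK <-; elim: (b - a)%N => [//|d IH].
exact: le_trans (gain_decr _) IH.
Qed.

Variable th : nat.
Hypothesis th_gt0 : (0 < th)%N.

(** Given only the prefix, each position of the block gains [gain a]; revealed in order they gain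
    [gain (a + i)]. The first terms cancel and each of the other [th.-1] is at least
    [gain (a + th)]. *)
Lemma avg_loss a :
  \sum_(s : 'S_n) loss h (initial a s) (initial a s) (take th (drop a (codom s))) <=
  (th.-1)%:R * (gain a - gain (a + th)).
Proof.
pose w := minn th (n - a).
have block_size s : size (take th (drop a (codom s))) = w.
  by rewrite size_take_min size_drop size_codom card_ord.
have w_le : (w <= th)%N by rewrite geq_minl.
rewrite /loss sumrB.
have -> : \sum_(s : 'S_n) (h (initial a s :|: [set i in take th (drop a (codom s))])
    - h (initial a s)) = avg (a + th) - avg a.
  rewrite /avg -sumrB; apply: eq_bigr => s _; congr (h _ - _).
  by apply/setP => i; rewrite !inE takeD mem_cat.
have -> : \sum_(s : 'S_n) \sum_(j <- take th (drop a (codom s)))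
    (h (j |: initial a s) - h (initial a s)) = w%:R * gain a.
  have [an|na] := ltnP a n; last first.
    rewrite /w (eqP na) minn0 mul0r big1 // => s _.
    by rewrite drop_oversize ?size_codom ?card_ord // big_nil.
  pose i0 := Ordinal an.
  transitivity (\sum_(s : 'S_n) \sum_(0 <= i < w)
      (h (s (nth i0 (enum 'I_n) (a + i)) |: initial a s) - h (initial a s))).
    apply: eq_bigr => s _; rewrite (big_nth i0) block_size big_nat [RHS]big_nat.
    apply: eq_bigr => i /= iw; rewrite nth_take ?(leq_trans iw) // nth_drop.
    rewrite codomE (nth_map i0) // size_enum_ord.
    by move: iw; rewrite /w leq_min => /andP[_]; rewrite ltn_subRL.
  rewrite exchange_big big_nat (eq_bigr (fun=> gain a)).
    by rewrite -big_nat sumr_const_nat subn0 mulr_natl.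
  move=> i /= iw; rewrite sumrB avg_insert //.
  rewrite nth_enum_ord ?leq_addr //.
  by move: iw; rewrite /w leq_min => /andP[_]; rewrite ltn_subRL.
have -> : avg (a + th) - avg a = \sum_(0 <= i < th) gain (a + i).
  rewrite (eq_bigr (fun i => avg (a + i.+1) - avg (a + i))).
    by rewrite telescope_sumr // addn0.
  by move=> i _; rewrite /gain addnS.
have ga := gain_ge0 a; case: th th_gt0 w_le => // d _ w_le.
rewrite big_nat_recl // addn0 /=.
have lb : d%:R * gain (a + d.+1) <= \sum_(0 <= i < d) gain (a + i.+1).
  rewrite mulr_natl -[X in _ *+ X]subn0 -sumr_const_nat big_nat [leRHS]big_nat.
  apply: ler_sum => i /= id; apply: gain_anti.
  by rewrite leq_add2l ltnS ltnW.
have ub : w%:R * gain a <= d.+1%:R * gain a by rewrite ler_wpM2r ?ler_nat.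
by rewrite -natr1 mulrDl mul1r in ub; rewrite [leRHS]mulrBr; lra.
Qed.

(** The losses of successive blocks telescope to [gain a], the final gain being nonnegative. *)
Lemma avg_budget m a :
  \sum_(s : 'S_n) budget h th (initial a s) (reshape (nseq m th) (drop a (codom s))) <=
  #|'S_n|%:R * (3 * m%:R) + (th * th.-1)%:R * gain a.
Proof.
elim: m a => [|m IH] a /=.
  by rewrite big1 // !mulr0 add0r mulr_ge0 ?ler0n ?gain_ge0.
have next s : initial a s :|: [set i in take th (drop a (codom s))] = initial (a + th) s.
  by apply/setP => i; rewrite !inE takeD mem_cat.
rewrite (eq_bigr (fun s => 3 +
    th%:R * loss h (initial a s) (initial a s) (take th (drop a (codom s))) +
    budget h th (initial (a + th) s) (reshape (nseq m th) (drop (a + th) (codom s))))); last first.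
  by move=> s _; rewrite next drop_drop addnC.
rewrite !big_split /= -mulr_sumr sumr_const.
apply: le_trans (lerD (lerD (lexx _) (ler_wpM2l (ler0n R th) (avg_loss a))) (IH _)) _.
have -> : m.+1%:R = m%:R + 1 :> R by rewrite natr1.
by rewrite natrM le_eqVlt; apply/orP; left; apply/eqP; ring.
Qed.

End Averaging.

(** * Series and numerical estimates *)

Section Series.
Variables (R : realType) (u : nat -> R) (l : R).
Hypothesis u_ge0 : forall k, 0 <= u k.
Hypothesis u_le : forall N, \sum_(0 <= k < N) u k <= l.

Lemma nneseries_fin_le : (\sum_(k <oo) (u k)%:E <= l%:E)%E.
Proof.
apply: lime_le; first by apply: is_cvg_nneseries => k _ _; rewrite lee_fin.
by apply: nearW => N; rewrite sumEFin lee_fin.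
Qed.

Lemma nneseries_fin_eq : (forall e, 0 < e -> exists N, l <= \sum_(0 <= k < N) u k + e) ->
  (\sum_(k <oo) (u k)%:E = l%:E)%E.
Proof.
move=> lu; apply/eqP; rewrite eq_le nneseries_fin_le /=; apply/lee_addgt0Pr => e e0.
have [N lN] := lu e e0.
apply: (@le_trans _ _ ((\sum_(0 <= k < N) u k)%:E + e%:E)%E); first by rewrite -EFinD lee_fin.
apply: leeD => //; rewrite -sumEFin; apply: nneseries_lim_ge => k _ _.
by rewrite lee_fin.
Qed.

End Series.

Section Numeric.
Variable R : realType.

(** Balances [n / th] against [th ^ 2 * ln q]; the lower cap covers the case where [ln q] exceeds
    [n]. *)
Definition block_size (n q : nat) :=
  maxn 1 (Num.trunc ((n%:R / ln q%:R : R) `^ (1/3))).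

Lemma ln_nat_ge (n : nat) : (2 <= n)%N -> 1/2 <= ln n%:R :> R.
Proof.
move=> n2; have n0 : 0 < n%:R :> R by rewrite ltr0n (leq_trans _ n2).
have := @ln_le_sub1 R n%:R^-1; rewrite invr_gt0 => /(_ n0).
rewrite lnV ?posrE // => h.
have : n%:R^-1 <= 2^-1 :> R by rewrite lef_pV2 ?posrE // ler_nat.
lra.
Qed.

Lemma powR_third3 (x : R) : 0 <= x -> (x `^ (1/3)) ^+ 3 = x.
Proof.
move=> x0; rewrite -powR_mulrn ?powR_ge0 // -powRrM.
by rewrite [_ * _](_ : _ = 1) ?powRr1 //; lra.
Qed.

Lemma powR_two_thirds (x : R) : 0 <= x -> x `^ (2/3) = (x `^ (1/3)) ^+ 2.
Proof.
move=> x0; rewrite -powR_mulrn ?powR_ge0 // -powRrM; congr (_ `^ _); lra.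
Qed.

Variables (n q : nat).
Hypotheses (n2 : (2 <= n)%N) (q2 : (2 <= q)%N).
Let th := block_size n q.

Lemma block_size_gt0 : (0 < th)%N.
Proof. by rewrite leq_maxl. Qed.

(** At the cap [th = 1] the inequality may fail, but there the entropy term vanishes through
    [th.-1]. *)
Lemma block_size_cube : (1 < th)%N -> th%:R ^+ 3 * ln q%:R <= n%:R :> R.
Proof.
move=> th1; have lnq := ln_nat_ge q2; have lnq0 : 0 < ln q%:R :> R by lra.
have nl0 : 0 <= n%:R / ln q%:R :> R by rewrite divr_ge0 ?ler0n ?(ltW lnq0).
have thE : th = Num.trunc ((n%:R / ln q%:R : R) `^ (1/3)).
  move: th1; rewrite /th /block_size leq_max ltnn /= => /ltnW.
  by move/maxn_idPr.
rewrite -ler_pdivlMr // -(powR_third3 nl0); apply: lerXn2r; rewrite ?nnegrE ?powR_ge0 //.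
by rewrite thE truncn_le powR_ge0.
Qed.

Lemma block_size_le : (th <= n)%N.
Proof.
have [th1|th1] := leqP th 1; first by rewrite (leq_trans th1) // ltnW.
have c := block_size_cube th1; have lnq := ln_nat_ge q2.
have t2 : 2 <= th%:R :> R by rewrite ler_nat.
have t3 : 4 * th%:R <= th%:R ^+ 3 :> R.
  have -> : th%:R ^+ 3 = th%:R ^+ 2 * th%:R :> R by ring.
  by rewrite ler_wpM2r ?ler0n //; nra.
rewrite -(ler_nat R); nra.
Qed.

Lemma n_div_block_size :
  n%:R / th%:R <= 2 * (n%:R `^ (2/3) * (ln q%:R) `^ (1/3)) :> R.
Proof.
have lnq := ln_nat_ge q2; have lnq0 : 0 < ln q%:R :> R by lra.
have n0 : 0 < n%:R :> R by rewrite ltr0n (leq_trans _ n2).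
set rho := (n%:R / ln q%:R : R) `^ (1/3).
have rho0 : 0 < rho by apply: powR_gt0; apply: divr_gt0.
(* Truncation loses less than one, and [th] is at least one. *)
have rho_th : rho <= 2 * th%:R.
  have : rho < (Num.trunc rho).+1%:R by apply: truncnS_gt.
  have : (Num.trunc rho).+1%:R <= (2 * th)%:R :> R.
    rewrite ler_nat mul2n -addnn -addn1 addnC leq_add //; first exact: block_size_gt0.
    by rewrite leq_maxr.
  by rewrite natrM; lra.
have nE : n%:R `^ (2/3) * (ln q%:R) `^ (1/3) * rho = n%:R :> R.
  have l1 : (ln q%:R : R) `^ (1/3) * rho = n%:R `^ (1/3).
    by rewrite -powRM ?ltW // ?divr_gt0 // mulrCA divff ?mulr1 ?gt_eqF.
  by rewrite -mulrA l1 powR_two_thirds ?ltW // -exprSr powR_third3 ?ltW.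
have th0 : 0 < th%:R :> R by rewrite ltr0n block_size_gt0.
rewrite ler_pdivrMr // -[leLHS]nE.
set z := n%:R `^ (2/3) * _; have z0 : 0 <= z by rewrite mulr_ge0 ?powR_ge0.
by nra.
Qed.

(** Weakens the bound obtained to the stated minimum. Since both logarithms are at least [1/2], the
    cube root of their product is at least [1/2], whose inverse square is [4]. *)
Lemma bound_min : (ln q%:R) `^ (1/3) <= 4 *
  Num.min ((ln n%:R) `^ (2/3) * ln q%:R) (q%:R `^ (1/3) * (ln q%:R) `^ (1/3)) :> R.
Proof.
have lnq := ln_nat_ge q2; have lnq0 : 0 < ln q%:R :> R by lra.
have lnn := ln_nat_ge n2; have lnn0 : 0 < ln n%:R :> R by lra.
have L0 : 0 <= (ln q%:R : R) `^ (1/3) by apply: powR_ge0.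
rewrite minr_pMr // le_min; apply/andP; split.
  have -> : (ln n%:R : R) `^ (2/3) * ln q%:R =
      ((ln n%:R * ln q%:R) `^ (1/3)) ^+ 2 * (ln q%:R) `^ (1/3).
    rewrite powRM ?ltW // exprMn -mulrA -exprSr powR_third3 ?ltW //.
    by rewrite powR_two_thirds ?ltW.
  set c := (_ * _) `^ _; have c0 : 0 <= c by apply: powR_ge0.
  have c3 : c ^+ 3 = ln n%:R * ln q%:R by apply: powR_third3; rewrite mulr_ge0 ?ltW.
  have c_half : 1/2 <= c.
    rewrite leNgt; apply/negP => ch.
    have : c ^+ 3 < 1/4.
      by rewrite exprS expr2; nra.
    by rewrite c3; nra.
  have : 1 <= 4 * c ^+ 2 by rewrite expr2; nra.
  by move=> h; rewrite mulrA -[leLHS]mul1r ler_wpM2r.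
have q1 : 1 <= q%:R `^ (1/3) :> R.
  have one : (1 : R) `^ (1/3) = 1 by rewrite powR1.
  rewrite -[leLHS]one; apply: ge0_ler_powR; rewrite ?nnegrE ?ler0n ?ler1n ?(ltnW q2) //; lra.
by nra.
Qed.

(** [7 = 3 + 3 + 1]: the full blocks, the extra block (as [th <= n]), and the entropy term. *)
Lemma rounds_numeric (E : R) :
  E <= 3 * (n %/ th).+1%:R + (th * th.-1)%:R * ln q%:R ->
  E <= 7 * (n%:R / th%:R).
Proof.
move=> /le_trans; apply; have lnq := ln_nat_ge q2.
have th0 : 0 < th%:R :> R by rewrite ltr0n block_size_gt0.
have h1 : 1 <= n%:R / th%:R :> R by rewrite ler_pdivlMr // mul1r ler_nat block_size_le.
have h2 : (n %/ th)%:R <= n%:R / th%:R :> R.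
  by rewrite ler_pdivlMr // -natrM ler_nat leq_trunc_div.
have h3 : (th * th.-1)%:R * ln q%:R <= n%:R / th%:R :> R.
  have [th1|th1] := leqP th 1; last first.
    rewrite ler_pdivlMr //; apply: le_trans (block_size_cube th1).
    rewrite -mulrA (mulrC (ln _)) mulrA ler_wpM2r //; first lra.
    rewrite -natrX -natrM ler_nat !expnS expn0 muln1 mulnA.
    by rewrite leq_mul2r leq_mul2l leq_pred !orbT.
  have -> : th = 1%N by apply/eqP; rewrite eqn_leq th1 block_size_gt0.
  by rewrite muln0 mul0r divr_ge0 ?ler0n.
by rewrite -natr1; lra.
Qed.

End Numeric.

(** * The theorem *)

Lemma blocks_size n th (s : 'S_n) : all (fun js => size js <= th)%N (blocks th s).
Proof.
rewrite /blocks; elim: (n %/ th).+1 (codom s) => [//|m IH] r /=.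
by rewrite size_take_min geq_minl IH.
Qed.

Lemma flatten_blocks n th (s : 'S_n) : (0 < th)%N -> flatten (blocks th s) = codom s.
Proof.
move=> th0; apply: reshapeKr; rewrite size_codom card_ord sumn_nseq mulnC.
exact/ltnW/ltn_ceil.
Qed.

Section Sampler.
Variables (R : realType) (n q' : nat) (th : nat).
Let q := q'.+1.
Hypotheses (n_gt0 : (0 < n)%N) (th_gt0 : (0 < th)%N).

Definition sampler : strategy R n q :=
  filtering (queries th) (step (R := R) th) (start R n q' th).

Lemma sampler_valid : valid_strategy sampler.
Proof.
apply: filtering_valid => [|O s]; first exact: (start_pmf _ _ _ _).1.
exact: (step_pmf _ _ _).1.
Qed.

Variables (mu : {ffun config n q -> R}) (O : oracle R n q).
Hypothesis mu_dist : is_distribution mu.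
Hypothesis O_cm : is_cm_oracle mu O.

Lemma remaining_unassigned c g rest :
  remaining th c g O rest (unassigned n q') =
  \sum_y mu y * remaining th c g O rest (restr finset.set0 y).
Proof.
rewrite (eq_bigr (fun y => mu y * remaining th c g O rest (unassigned n q'))).
  by rewrite -mulr_suml mu_dist.2 mul1r.
move=> y _; congr (_ * remaining th c g O rest _).
by apply/ffunP => i; rewrite !ffunE inE.
Qed.

(** At zero cost the potential is the mean reward of the output, and every fixed order already
    samples [mu] exactly. *)
Lemma start_law g :
  expect (start R n q' th) (value g (potential th 0 g O)) = \sum_y mu y * g y.
Proof.
rewrite potential_start (eq_bigr (fun=> \sum_y mu y * g y)).
  rewrite sumr_const -[X in _ * X]mulr_natl mulrA mulVf ?mul1r // pnatr_eq0 -lt0n.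
  by apply/card_gt0P; exists 1%g.
move=> s _; rewrite remaining_unassigned remaining_law ?blocks_size //.
apply: eq_bigr => y _; congr (_ * g _); rewrite flatten_blocks //.
rewrite (_ : _ :|: _ = finset.setT) ?output_restr //.
apply/setP => i; rewrite !inE; apply/codomP; exists (s^-1%g i).
by rewrite permKV.
Qed.

Lemma start_rounds :
  expect (start R n q' th) (value (fun=> 0) (potential th 1 (fun=> 0) O)) <=
  3 * (n %/ th).+1%:R + (th * th.-1)%:R * ln q%:R.
Proof.
have N0 : 0 < #|'S_n|%:R :> R.
  by rewrite ltr0n; apply/card_gt0P; exists 1%g.
rewrite potential_start mulrC ler_pdivrMr //.
have submod A i j := entropy_submodular mu_dist O_cm A i j.
have mono A j := entropy_mono mu_dist A j.
have := avg_budget submod mono th_gt0 (n %/ th).+1 0.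
have -> : \sum_(s : 'S_n) budget (entropy mu) th (initial 0 s)
      (reshape (nseq (n %/ th).+1 th) (drop 0 (codom s))) =
    \sum_(s : 'S_n) budget (entropy mu) th finset.set0 (blocks th s).
  apply: eq_bigr => s _; rewrite drop0; congr (budget _ _ _ _).
  by apply/setP => i; rewrite !inE take0.
move=> ub.
have gain_le : gain (entropy mu) 0 <= #|'S_n|%:R * ln q%:R.
  rewrite /gain /avg -sumrB mulr_natl -sumr_const; apply: ler_sum => s _.
  by rewrite (initialS (Ordinal n_gt0)) (entropy_cap mu_dist O_cm).
apply: le_trans (_ : _ <= \sum_(s : 'S_n) budget (entropy mu) th finset.set0 (blocks th s)) _.
  apply: ler_sum => s _; rewrite remaining_unassigned.
  by apply: remaining_bound; rewrite ?blocks_size.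
apply: le_trans ub _; rewrite [leRHS]mulrC [leRHS]mulrDr lerD2l mulrCA.
by rewrite ler_wpM2l ?ler0n.
Qed.

Let E := 3 * (n %/ th).+1%:R + (th * th.-1)%:R * ln q%:R : R.

(* Side conditions of the lemmas on [filtering], found by [//]. *)
Let s0 := (start_pmf R n q' th).1.
Let s1 := (start_pmf R n q' th).2.
Let st0 := fun O s => (@step_pmf R n q' th O s).1.
Let st1 := fun O s => (@step_pmf R n q' th O s).2.
Let loc := @step_local R n q' th.

Lemma sum_alive N : \sum_(0 <= k < N) alive (step (R := R) th) (start R n q' th) O k <= E.
Proof.
apply: le_trans start_rounds.
rewrite (potential_chain (c := 1) _ N (potential_step _ _ _ O)).
rewrite mul1r -addrA lerDl addr_ge0 //.
  apply: sumr_ge0 => k _; apply: expect_ge0; first exact: dnonneg_chain.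
  by case.
apply: expect_ge0; first exact: dnonneg_chain.
by case=> //= s; apply: potential_ge0.
Qed.

Lemma sum_rounds_le N :
  \sum_(0 <= k < N.+1) k%:R * stop_prob sampler O k + 
  N%:R * alive (step (R := R) th) (start R n q' th) O N <= E.
Proof. by rewrite sum_rounds //; apply: sum_alive. Qed.

(** At a finite time only an upper bound holds: the nonnegative potential of the runs still active
    is dropped. *)
Lemma sum_out_le g N : (forall y, 0 <= g y) ->
  \sum_(0 <= k < N) \sum_x out_prob sampler O k x * g x <= \sum_y mu y * g y.
Proof.
move=> g0; rewrite -start_law.
rewrite (potential_chain (c := 0) _ N (potential_step _ _ _ O)) mul0r add0r.
rewrite -[leLHS]addr0 lerD //.
  rewrite le_eqVlt; apply/orP; left; apply/eqP; apply: eq_bigr => k _.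
  under eq_bigr do rewrite out_probE // mulrC -expectZ.
  rewrite -expect_sum; apply: eq_expect => -[s|x] /=.
    by rewrite big1 // => x _; rewrite mulr0.
  rewrite (bigD1 x) //= eqxx mulr1 big1 ?addr0 // => y yx.
  by rewrite [_ == _](_ : _ = (x == y)) // eq_sym (negbTE yx) mulr0.
apply: expect_ge0; first exact: dnonneg_chain.
by case=> //= s; apply: potential_ge0.
Qed.

Lemma out_prob_ge0 k x : 0 <= out_prob sampler O k x.
Proof.
by rewrite out_probE //; apply: expect_ge0 => [|z]; [apply: dnonneg_chain | apply: ler0n].
Qed.

(** The finite-time outputs stay below [mu] both at [x] and on its complement, while the total
    stopped mass tends to one because the mean number of rounds is bounded. So neither bound can be
    strict in the limit. *)
Lemma sampler_law x : (\sum_(k <oo) (out_prob sampler O k x)%:E = (mu x)%:E)%E.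
Proof.
apply: nneseries_fin_eq => [k|N|e e0]; first exact: out_prob_ge0.
  have := sum_out_le (g := fun y => (y == x)%:R) N (fun=> ler0n _ _).
  rewrite [leRHS](bigD1 x) //= eqxx mulr1 [X in _ <= _ + X]big1 ?addr0; last first.
    by move=> y /negbTE->; rewrite mulr0.
  apply: le_trans; rewrite le_eqVlt; apply/orP; left; apply/eqP.
  apply: eq_bigr => k _; rewrite (bigD1 x) //= eqxx mulr1 big1 ?addr0 //.
  by move=> y /negbTE->; rewrite mulr0.
have E0 : 0 <= E by apply: le_trans (sum_alive 0); rewrite big_geq.
have Ee0 : 0 <= E / e by rewrite divr_ge0 ?(ltW e0).
(* Markov's inequality: after [N] rounds the active mass is at most [E / N], hence at most [e]. *)
pose N := Num.bound (E / e); have EN : E / e < N%:R by apply: archi_boundP.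
have N0 : 0 < N%:R :> R := le_lt_trans Ee0 EN.
exists N.+1.
have al : N%:R * alive (step (R := R) th) (start R n q' th) O N <= E.
  apply: le_trans (sum_rounds_le N); rewrite lerDr sumr_ge0 // => k _.
  by rewrite mulr_ge0 ?ler0n // stop_prob_ge0.
have ale : alive (step (R := R) th) (start R n q' th) O N <= e.
  rewrite -(ler_pM2l N0); apply: le_trans al _.
  by rewrite -ler_pdivrMr // ltW.
have := sum_out_le (g := fun y => (y != x)%:R) N.+1 (fun=> ler0n _ _).
have -> : \sum_y mu y * (y != x)%:R = 1 - mu x.
  rewrite -[X in X - _]mu_dist.2 [in RHS](bigD1 x) //= addrC addrK [RHS]big_mkcond.
  by apply: eq_bigr => y _; case: eqP => _; rewrite ?mulr0 ?mulr1.
have -> : \sum_(0 <= k < N.+1) \sum_y out_prob sampler O k y * (y != x)%:R =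
    \sum_(0 <= k < N.+1) stop_prob sampler O k - \sum_(0 <= k < N.+1) out_prob sampler O k x.
  rewrite -sumrB; apply: eq_bigr => k _.
  rewrite /stop_prob [in RHS](bigD1 x) //= addrC addrK [RHS]big_mkcond.
  by apply: eq_bigr => y _; case: eqP => _; rewrite ?mulr0 ?mulr1.
rewrite sum_stop_prob //; lra.
Qed.

Lemma sampler_rounds :
  (\sum_(k <oo) (k%:R * stop_prob sampler O k)%:E <= E%:E)%E.
Proof.
apply: nneseries_fin_le => [k|[|N]]; first by rewrite mulr_ge0 ?ler0n // stop_prob_ge0.
  by apply: le_trans (sum_alive 0); rewrite !big_geq.
apply: le_trans (sum_rounds_le N); rewrite lerDl mulr_ge0 ?ler0n //.
exact: alive_ge0.
Qed.

Lemma sampler_queries :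
  (\sum_(k <oo) (query_mass sampler O k)%:E <= ((2 * th)%:R * E)%:E)%E.
Proof.
apply: nneseries_fin_le => [k|N]; first exact: query_mass_ge0.
apply: le_trans (_ : _ <= \sum_(0 <= k < N) (2 * th)%:R * (k%:R * stop_prob sampler O k)) _.
  by apply: ler_sum => k _; apply: query_mass_le => // s; apply: card_queries.
rewrite -mulr_sumr ler_wpM2l ?ler0n //; case: N => [|N].
  by apply: le_trans (sum_alive 0); rewrite !big_geq.
apply: le_trans (sum_rounds_le N); rewrite lerDl mulr_ge0 ?ler0n //.
exact: alive_ge0.
Qed.

End Sampler.

Theorem theorem1p1 (R : realType) :
  exists (A : forall n q : nat, strategy R n q) (C : R), 0 < C /\
  forall n q : nat, (2 <= n)%N -> (2 <= q)%N ->
    valid_strategy (A n q) /\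
    forall (mu : {ffun config n q -> R}), is_distribution mu ->
    forall (O : oracle R n q), is_cm_oracle mu O ->
      (* the output has law exactly mu *)
      (forall x : config n q,
         (\sum_(k <oo) (out_prob (A n q) O k x)%:E = (mu x)%:E)%E) /\
      (* expected total number of queries at most C n *)
      (\sum_(k <oo) (query_mass (A n q) O k)%:E <= (C * n%:R)%:E)%E /\
      (* expected number of rounds *)
      (\sum_(k <oo) (k%:R * stop_prob (A n q) O k)%:E <=
         (C * (n%:R `^ (2/3)) *
            Num.min ((ln n%:R) `^ (2/3) * ln q%:R)
                    (q%:R `^ (1/3) * (ln q%:R) `^ (1/3)))%:E)%E.
Proof.
(* The strategy at [q = 0] is a placeholder. The constant is [56 = 7 * 2 * 4], from
   [rounds_numeric], [n_div_block_size] and [bound_min]; the query bound uses [14 = 2 * 7]. *)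
exists (fun n q => if q is q'.+1 then @sampler R n q' (block_size R n q'.+1)
                   else fun=> [ffun=> 0]), 56.
split=> // n [//|q'] n2 q2; have th0 := block_size_gt0 R n q'.+1.
split; first exact: sampler_valid.
move=> mu mu_dist O O_cm; have n0 : (0 < n)%N by apply: leq_trans n2.
have thR : 0 < (block_size R n q'.+1)%:R :> R by rewrite ltr0n.
have E_le := rounds_numeric n2 q2 (lexx (3 * (n %/ block_size R n q'.+1).+1%:R
  + (block_size R n q'.+1 * (block_size R n q'.+1).-1)%:R * ln q'.+1%:R)).
split; first exact: sampler_law.
split.
  apply: le_trans (sampler_queries n0 th0 mu_dist O_cm) _; rewrite lee_fin.
  apply: le_trans (ler_wpM2l (ler0n _ _) E_le) _.
  rewrite natrM.
  have -> : 2 * (block_size R n q'.+1)%:R * (7 * (n%:R / (block_size R n q'.+1)%:R))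
      = 14 * n%:R :> R by field; rewrite gt_eqF.
  by rewrite ler_wpM2r ?ler0n //; lra.
apply: le_trans (sampler_rounds n0 th0 mu_dist O_cm) _; rewrite lee_fin.
have := n_div_block_size R n2 q2; have := bound_min R n2 q2.
set m := Num.min _ _; set z := n%:R `^ _; set l := (ln q'.+1%:R) `^ (1/3).
move=> lm zl; have z0 : 0 <= z by apply: powR_ge0.
have := ler_wpM2l z0 lm; rewrite -[56 * z * m]mulrA; lra.
Qed.
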